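(* Consider the two-stage interacting tempering process $\{X_n,n\ge0\}$ with auxiliary process $\{Y_n,n\ge0\}$ described in the context. Assume: (I1) $\pi$ is a continuous positive density on $\mathsf{X}$ and $\|\pi\|_\infty<+\infty$; (I2)(a) $P$ is a $\pi$-irreducible aperiodic Feller transition kernel on $(\mathsf{X},\mathcal{X})$ such that $\pi P=\pi$; (I2)(b) there exist $\tau\in(0,1/T)$, $\lambda\in(0,1)$ and $b<+\infty$ such that $PW\le\lambda W+b$ with $W(x)=(\pi(x)/\|\pi\|_\infty)^{-\tau}$; (I2)(c) for every $p\in(0,\|\pi\|_\infty)$, the set $\{\pi\ge p\}$ is $1$-small for $P$; (I3)(a) $\theta_\star(W)<+\infty$ and for every continuous function $f$ with $\sup_x|f(x)|/W(x)<\infty$, $\theta_n(f)\to\theta_\star(f)$ almost surely; (I3)(b) $\sup_n\mathbb{E}[W(Y_n)]<+\infty$; and $\mathbb{E}[W(X_0)]<+\infty$. Then for every bounded continuous function $f:\mathsf{X}\to\mathbb{R}$, $$\lim_{n\to\infty}\mathbb{E}[f(X_n)]=\pi(f).$$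
   Context: $\mathsf{X}$ is a Polish space with Borel $\sigma$-field $\mathcal{X}$, $\pi$ is a probability density with respect to a measure $\mu$ on $(\mathsf{X},\mathcal{X})$; $\pi$ also denotes the distribution $\pi\,d\mu$. Fix $T>1$, $\upsilon\in(0,1)$, and a Markov kernel $P$ on $(\mathsf{X},\mathcal{X})$. $\Theta$ is the set of all probability measures on $(\mathsf{X},\mathcal{X})$. For $\theta\in\Theta$, $P_\theta(x,\cdot)=(1-\upsilon)P(x,\cdot)+\upsilon K_\theta(x,\cdot)$ with $$K_\theta(x,A)=\int_A\alpha(x,y)\theta(dy)+\mathbf{1}_A(x)\int\{1-\alpha(x,y)\}\theta(dy),\qquad \alpha(x,y)=1\wedge\frac{\pi^\beta(y)}{\pi^\beta(x)},\quad\beta=1-\frac1T .$$ $\theta_\star\in\Theta$ is the probability distribution with density with respect to $\mu$ proportional to $\pi^{1/T}$. $\{Y_n,n\ge0\}$ is an $\mathsf{X}$-valued process (not necessarily Markov) such that for every bounded continuous $f$, $n^{-1}\sum_{k=1}^nf(Y_k)\to\theta_\star(f)$ a.s. Let $\theta_n(f)=(n+1)^{-1}\sum_{k=0}^nf(Y_k)$. The process $\{X_n,n\ge0\}$ is such that $(X_n,\theta_n)$ is adapted to a filtration $\{\mathcal{F}_n\}$ and $\mathbb{E}[f(X_{n+1})\mid\mathcal{F}_n]=P_{\theta_n}f(X_n)$ for every $n\ge0$ and bounded measurable $f$. A kernel is Feller if it maps bounded continuous functions to bounded continuous functions. A set $C$ is $1$-small for a kernel $Q$ if there exist $\delta>0$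 and a probability measure $\nu$ with $Q(x,\cdot)\ge\delta\nu(\cdot)$ for all $x\in C$. *)

(* Defs.v *)
From HB Require Import structures.
From mathcomp Require Import all_boot all_order all_algebra.
From mathcomp Require Import all_classical all_reals all_analysis.
From mathcomp Require Import measurable_realfun.

Set Implicit Arguments.
Unset Strict Implicit.
Unset Printing Implicit Defensive.

Import Order.TTheory GRing.Theory Num.Theory.
Import numFieldNormedType.Exports.

Local Open Scope classical_set_scope.
Local Open Scope ring_scope.

(* A Polish space presented by one of its complete metrics and equipped with
   its Borel sigma-field. *)
HB.mixin Record isPolishBorel (R : realType) d T
    & Metric R T & Complete T & Measurable d T := {
  measurable_borel : @measurable d T = <<s @open T >> ;
  separable : exists2 D : set T, countable D & dense D }.

#[short(type="polishType")]
HB.structure Definition Polish (R : realType) d :=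
  { T of Metric R T & Complete T & Measurable d T & isPolishBorel R d T }.

Section functions.
Context (R : realType).

Definition supnorm (T : Type) (f : T -> R) : R := sup (range (fun x => `|f x|)).

Definition lyapunov (T : Type) (p : T -> R) (tau : R) (x : T) : R :=
  (p x / supnorm p) `^ (- tau).

End functions.

Section kernels.
Context d (S : measurableType d) (R : realType).
Implicit Types (P : R.-pker S ~> S) (phi : probability S R).

Definition has_density (mu : {measure set S -> \bar R}) phi (f : S -> R) :=
  forall A, measurable A -> (phi A = \int[mu]_(x in A) (f x)%:E)%E.

Fixpoint kernel_pow P n : S -> set S -> \bar R :=
  if n is m.+1 then fun x A => (\int[P x]_y kernel_pow P m y A)%E
  else fun x A => \d_x A.

Definition invariant_for P phi :=
  forall A, measurable A -> (\int[phi]_x P x A = phi A)%E.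

Definition phi_irreducible phi P :=
  forall A, measurable A -> (0 < phi A)%E ->
  forall x, exists n, (0 < kernel_pow P n.+1 x A)%E.

Definition cyclic_partition phi P k (D : 'I_k -> set S) :=
  [/\ forall i, measurable (D i),
      trivIset setT D,
      forall i x, D i x -> P x (D (ordS i)) = 1%E &
      phi (~` \bigcup_i D i) = 0%E].

(* Meyn-Tweedie: a [phi]-irreducible kernel is aperiodic when its longest cycle
   has length 1.  The cycle is required to be [phi]-full; since a nonempty
   absorbing set is full for the maximal irreducibility measure, this does not
   depend on the choice of the irreducibility measure. *)
Definition aperiodic phi P :=
  forall k (D : 'I_k -> set S), cyclic_partition phi P D -> (k <= 1)%N.

Definition small1 P (C : set S) :=
  exists2 delta : R, 0 < delta & exists nu : probability S R,
  forall x A, C x -> measurable A -> (delta%:E * nu A <= P x A)%E.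

End kernels.

Definition feller (R : realType) d (S : polishType R d) (P : R.-pker S ~> S) :=
  forall f : S -> R, continuous f -> bounded_fun f ->
    let Pf x := \int[P x]_y f y in continuous Pf /\ bounded_fun Pf.

Section interacting_tempering.
Local Open Scope ereal_scope.
Context d (S : measurableType d) (R : realType).
Variables (p : {mfun S >-> R}) (beta : R).

Definition acceptance (x y : S) : R :=
  Num.min 1%R (p y `^ beta / p x `^ beta)%R.

Lemma acceptance_ge0 x y : (0 <= acceptance x y)%R.
Proof. by rewrite le_min ler01 divr_ge0// powR_ge0. Qed.

Lemma acceptance_le1 x y : (acceptance x y <= 1)%R.
Proof. by rewrite ge_min lexx. Qed.

Lemma measurable_acceptance :
  measurable_fun setT (fun z : S * S => acceptance z.1 z.2).
Proof.
have mp : measurable_fun setT (fun x : S => p x `^ beta)%R.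
  exact: (measurableT_comp (measurable_powR beta) (measurable_funPT p)).
apply: measurable_minr => //; apply: measurable_funM.
  by apply: (measurableT_comp mp); exact: measurable_snd.
have -> : (fun z : S * S => (p z.1 `^ beta)^-1)%R =
          (fun z : S * S => p z.1 `^ (- beta))%R.
  by apply/funext => z; rewrite powRN.
apply: (measurableT_comp (measurable_powR (- beta)%R)).
by apply: (measurableT_comp (measurable_funPT p)); exact: measurable_fst.
Qed.

Let measurable_acceptancer x :
  measurable_fun setT (fun y => (acceptance x y)%:E).
Proof.
apply/measurable_EFinP.
exact: (measurableT_comp measurable_acceptance (pair1_measurable x)).
Qed.

Let measurable_rejectionr x :
  measurable_fun setT (fun y => (1 - acceptance x y)%:E).
Proof.
apply/measurable_EFinP; apply: measurable_funB => //.
exact/measurable_EFinP/measurable_acceptancer.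
Qed.

Variable theta : probability S R.

Definition Ktheta (x : S) (A : set S) : \bar R :=
  \int[theta]_(y in A) (acceptance x y)%:E
  + \d_x A * \int[theta]_y (1 - acceptance x y)%:E.

Let rejection_ge0 x : 0 <= \int[theta]_y (1 - acceptance x y)%:E.
Proof.
by apply: integral_ge0 => y _; rewrite lee_fin subr_ge0 acceptance_le1.
Qed.

Let acceptance_rejection x :
  \int[theta]_y (acceptance x y)%:E
  + \int[theta]_y (1 - acceptance x y)%:E = 1.
Proof.
rewrite -ge0_integralD//=; first last.
- by move=> y _; rewrite lee_fin subr_ge0 acceptance_le1.
- by move=> y _; rewrite lee_fin acceptance_ge0.
under eq_integral do rewrite -EFinD subrKC.
by rewrite integral_cst// mul1e; exact: probability_setT.
Qed.

Let rejection_fin_num x :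
  \int[theta]_y (1 - acceptance x y)%:E \is a fin_num.
Proof.
rewrite ge0_fin_numE//; apply: (@le_lt_trans _ _ 1); last exact: ltry.
rewrite -(acceptance_rejection x) leeDr//.
by apply: integral_ge0 => y _; rewrite lee_fin acceptance_ge0.
Qed.

Let Ktheta0 x : Ktheta x set0 = 0.
Proof. by rewrite /Ktheta integral_set0 measure0 mul0e adde0. Qed.

Let Ktheta_ge0 x A : 0 <= Ktheta x A.
Proof.
apply: adde_ge0; last by apply: mule_ge0.
by apply: integral_ge0 => y _; rewrite lee_fin acceptance_ge0.
Qed.

Let Ktheta_sigma_additive x : semi_sigma_additive (Ktheta x).
Proof.
move=> F mF tF mUF; rewrite /Ktheta.
under eq_fun do rewrite big_split/=.
apply: cvgeD.
- apply: ge0_adde_def; rewrite inE.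
    by apply: integral_ge0 => y _; rewrite lee_fin acceptance_ge0.
  by apply: mule_ge0.
- apply: semi_sigma_additive_nng_induced => // y.
  by rewrite lee_fin acceptance_ge0.
- under eq_fun do rewrite -ge0_sume_distrl//.
  by apply: cvgeZr => //; exact: measure_semi_sigma_additive.
Qed.

HB.instance Definition _ x := isMeasure.Build _ _ _ (Ktheta x)
  (Ktheta0 x) (Ktheta_ge0 x) (@Ktheta_sigma_additive x).

Definition Kkernel : S -> {measure set S -> \bar R} := Ktheta.

Let measurable_Ktheta U :
  measurable U -> measurable_fun setT (Kkernel ^~ U).
Proof.
move=> mU; apply: emeasurable_funD.
  under eq_fun do rewrite integral_mkcond.
  apply: (@measurable_fun_fubini_tonelli_F _ _ _ _ _ theta
    (fun z => ((fun y => (acceptance z.1 y)%:E) \_ U) z.2)).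
    rewrite (_ : (fun z => _) = (fun z : S * S => (acceptance z.1 z.2)%:E) \_ (setT `*` U)).
      apply/(measurable_restrictT _ _).1; first exact: measurableX.
      by apply: measurable_funTS; apply/measurable_EFinP; exact: measurable_acceptance.
    apply/funext => z; rewrite /patch; congr (if _ then _ else _).
    by apply/idP/idP; rewrite !inE//= => -[].
  by move=> z; rewrite /patch; case: ifP => // _; rewrite lee_fin acceptance_ge0.
apply: emeasurable_funM; first exact: measurable_fun_dirac.
apply: (@measurable_fun_fubini_tonelli_F _ _ _ _ _ theta
  (fun z => (1 - acceptance z.1 z.2)%:E)).
  by apply/measurable_EFinP; apply: measurable_funB => //; exact: measurable_acceptance.
by move=> z; rewrite lee_fin subr_ge0 acceptance_le1.
Qed.

HB.instance Definition _ := isKernel.Build _ _ _ _ _ Kkernel measurable_Ktheta.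

Let Ktheta_setT x : Kkernel x setT = 1.
Proof.
rewrite /Kkernel/= /Ktheta.
by rewrite diracT mul1e.
Qed.

HB.instance Definition _ :=
  Kernel_isProbability.Build _ _ _ _ _ Kkernel Ktheta_setT.

Variables (P : R.-pker S ~> S) (v : R) (v01 : (0 < v < 1)%R).

Lemma mixture_weight_ge0 : (0 <= v)%R.
Proof. by case/andP: v01 => /ltW. Qed.

Lemma mixture_weightC_ge0 : (0 <= 1 - v)%R.
Proof. by case/andP: v01 => _ /ltW; rewrite subr_ge0. Qed.

Definition Ptheta (x : S) : {measure set S -> \bar R} :=
  measure_add (mscale (NngNum mixture_weightC_ge0) (P x))
              (mscale (NngNum mixture_weight_ge0) (Kkernel x)).

Lemma PthetaE x A :
  Ptheta x A = (1 - v)%:E * P x A + v%:E * Ktheta x A.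
Proof. exact: measure_addE. Qed.

Let measurable_Ptheta U : measurable U -> measurable_fun setT (Ptheta ^~ U).
Proof.
move=> mU; under eq_fun do rewrite PthetaE.
apply: emeasurable_funD; apply: emeasurable_funM => //.
  exact: measurable_kernel.
exact: measurable_Ktheta.
Qed.

HB.instance Definition _ := isKernel.Build _ _ _ _ _ Ptheta measurable_Ptheta.

Let Ptheta_setT x : Ptheta x setT = 1.
Proof.
rewrite PthetaE prob_kernel [Ktheta _ _]Ktheta_setT !mule1 -EFinD.
by rewrite subrK.
Qed.

HB.instance Definition _ :=
  Kernel_isProbability.Build _ _ _ _ _ Ptheta Ptheta_setT.

End interacting_tempering.

Section empirical_measure.
Context d (S : measurableType d) (R : realType) (u : nat -> S) (n : nat).

Definition empirical : set S -> \bar R :=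
  mscale (n.+1%:R^-1 : R)%:nng (msum (fun k => \d_(u k)) n.+1).

HB.instance Definition _ := Measure.on empirical.

Lemma empiricalE A :
  (empirical A = (n.+1%:R^-1 : R)%:E * \sum_(k < n.+1) \d_(u k) A)%E.
Proof. by []. Qed.

Let empirical_setT : empirical setT = 1%E.
Proof.
rewrite empiricalE; under eq_bigr do rewrite diracT.
rewrite sumEFin -EFinM; congr EFin.
by rewrite sumr_const card_ord/= mulVf// pnatr_eq0.
Qed.

HB.instance Definition _ :=
  Measure_isProbability.Build _ _ _ empirical empirical_setT.

End empirical_measure.

Section conditional_expectation.
Context d (O : measurableType d) (R : realType) (Pr : probability O R).

Definition filtration (F : nat -> set (set O)) :=
  [/\ forall n, sigma_algebra setT (F n),
      forall n, F n `<=` measurable &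
      forall m n, (m <= n)%N -> F m `<=` F n].

Definition measurable_for (G : set (set O)) d' (T : measurableType d')
    (f : O -> T) :=
  forall B, measurable B -> G (f @^-1` B).

(* [V] is a version of the conditional expectation of [Z] given [G]. *)
Definition is_condexp (G : set (set O)) (Z V : O -> R) :=
  [/\ measurable_for G V,
      Pr.-integrable setT (EFin \o V) &
      forall A, G A ->
        (\int[Pr]_(w in A) (V w)%:E = \int[Pr]_(w in A) (Z w)%:E)%E].

End conditional_expectation.

(* Main.v *)
Require Import Defs.
From HB Require Import structures.
From mathcomp Require Import all_boot all_order all_algebra.
From mathcomp Require Import all_classical all_reals all_analysis.
From mathcomp Require Import measurable_realfun ring lra.
Import Order.TTheory GRing.Theory Num.Theory.
Import numFieldNormedType.Exports.

(** Over a window of fixed length [m], starting at a late time [n], the process [X]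
    moves almost like a Markov chain with kernel [Q = P_theta_star], and after [m]
    steps such a chain has nearly forgotten where it was at time [n].  Comparing
    with the single kernel [Q] dispenses with the invariant measures of the
    adapted kernels [P_theta_n] and with rates of convergence for them.

    One step.  For [g] bounded and continuous, [E g (X n.+1) - E (Q g) (X n)]
    tends to 0 ([one_step_replacement]).  The difference of the two kernels at [x]
    is an integral of [alpha x y * (g y - g x)] in [y] against
    [theta_n - theta_star], and it depends on [x] only through the two numbers
    [pi x ^ beta] and [g x], the first one in a Lipschitz way.  A finite grid of
    values therefore upgrades the law of large numbers to one that is uniform in
    [x] where [pi x] is bounded away from 0 ([uniform_lln]).  Elsewhere [W] is
    large, and Markov's inequality applies because the moments [E W (X n)] are
    bounded: [P] contracts [W], while a tempering move adds at most [theta_n W]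
    to it ([moment_bound]).

    Many steps.  Since [Q] is Feller ([feller_Ptheta]), the one-step estimates
    telescope: [E f (X (n + m)) - E (Q^m f) (X n)] tends to 0 for every fixed [m]
    ([lagged_replacement]).

    Ergodicity of [Q].  The kernel [Q] inherits from [P] a geometric drift
    towards small values of [W] ([drift_Ptheta]) and the smallness of all sublevel
    sets of [W] ([small_Ptheta]), so [Q^m f] is within a multiple of
    [kappa ^+ m * (1 + eta W)] of a constant ([harris_ergodic]).  Moreover [pi] is
    invariant for [Q] by detailed balance ([invariant_Ptheta]) and integrates [W]
    ([tempered_moment]).  Integrating that estimate against the law of [X n] and
    against [pi] shows that both [E (Q^m f) (X n)] and [pi f] are within
    [O (kappa ^+ m)] of the same constant, uniformly in [n]
    ([asymptotically_markov_cvg]). *)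

Set Implicit Arguments.
Unset Strict Implicit.
Unset Printing Implicit Defensive.

Local Open Scope classical_set_scope.
Local Open Scope ring_scope.

(** * Bounded functions and mixtures of measures *)

Section bounded_integrals.
Context d (S : measurableType d) (R : realType).
Implicit Types (m : {measure set S -> \bar R}) (f g : S -> R).

Lemma bounded_funP (T : Type) (f : T -> R) :
  bounded_fun f <-> exists2 B : R, 0 <= B & forall x, `|f x| <= B.
Proof.
split=> [[M [_ Mf]]|[B _ fB]].
  exists (`|M| + 1); first by rewrite addr_ge0.
  by move=> x; apply: Mf => //; rewrite ltr_pwDr// ler_norm.
by exists B; split; rewrite ?num_real// => M BM x _; exact: le_trans (fB x) (ltW BM).
Qed.

Lemma integrable_bounded m f B : m setT = 1%E -> measurable_fun setT f ->
  (forall x, `|f x| <= B) -> m.-integrable setT (EFin \o f).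
Proof.
move=> m1 mf fB; apply: measurable_bounded_integrable => //.
  by rewrite m1 ltry.
by exists B; split; rewrite ?num_real// => M BM x _; exact: le_trans (fB x) (ltW BM).
Qed.

Lemma Rintegral_cst_prob m r : m setT = 1%E -> \int[m]_x r = r.
Proof. by move=> m1; rewrite Rintegral_cst// m1/= mulr1. Qed.

Lemma integrable_cst m r : m setT = 1%E -> m.-integrable setT (fun=> r%:E).
Proof. by move=> m1; apply: (@integrable_bounded _ (fun=> r) `|r|). Qed.

Lemma EFin_Rintegral m f : m.-integrable setT (EFin \o f) ->
  (\int[m]_x f x)%:E = (\int[m]_x (f x)%:E)%E.
Proof. by move=> mf; rewrite /Rintegral fineK//; exact: integrable_fin_num. Qed.

Lemma RintegralDcst m f r : m setT = 1%E -> m.-integrable setT (EFin \o f) ->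
  \int[m]_x (f x + r) = \int[m]_x f x + r.
Proof. by move=> m1 mf; rewrite RintegralD//= ?Rintegral_cst_prob//; exact: integrable_cst. Qed.

Lemma ler_norm_Rintegral m f B : m setT = 1%E -> measurable_fun setT f ->
  (forall x, `|f x| <= B) -> `|\int[m]_x f x| <= B.
Proof.
move=> m1 mf fB; have fi := integrable_bounded m1 mf fB.
apply: le_trans (le_normr_Rintegral _ _) _ => //.
rewrite -[leRHS](Rintegral_cst_prob _ m1); apply: le_Rintegral => //.
  exact: integrable_norm.
exact: integrable_cst.
Qed.

(** Shifting by a bound reduces measurability to the nonnegative case. *)
Lemma measurable_kernel_Rintegral d' (T : measurableType d')
    (q : T -> {measure set S -> \bar R}) f B :
  (forall U, measurable U -> measurable_fun setT (q ^~ U)) ->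
  (forall x, q x setT = 1%E) -> measurable_fun setT f -> (forall x, `|f x| <= B) ->
  measurable_fun setT (fun x => \int[q x]_y f y).
Proof.
move=> mq q1 mf fB.
have -> : (fun x => \int[q x]_y f y) = (fun x => \int[q x]_y (f y + B) - B).
  apply/funext => x; rewrite RintegralDcst ?addrK//.
  exact: integrable_bounded (q1 x) mf fB.
apply: measurable_funB => //; apply: measurableT_comp => //.
apply: measurable_fun_integral_kernel => //.
  by move=> y; rewrite lee_fin -lerBlDr sub0r; have := fB y; rewrite ler_norml => /andP[].
by apply/measurable_EFinP; exact: measurable_funD.
Qed.

End bounded_integrals.

Section mixture.
Context d1 d2 (Y : measurableType d1) (Z : measurableType d2) (R : realType).
Variables (m : {measure set Y -> \bar R}) (nu : {measure set Z -> \bar R}).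
Variable q : Y -> {measure set Z -> \bar R}.
Hypothesis mq : forall U, measurable U -> measurable_fun setT (q ^~ U).
Hypothesis nuE : forall A, measurable A -> (nu A = \int[m]_y q y A)%E.
Local Open Scope ereal_scope.

Import HBNNSimple.

Let integral_nnsfunE d (T : measurableType d) (k : {measure set T -> \bar R})
    (f : {nnsfun T >-> R}) :
  \int[k]_z (f z)%:E = \sum_(r \in range f) r%:E * k (f @^-1` [set r]).
Proof. by rewrite integral_nnsfun// patch_setT sintegralE. Qed.

Let integral_mixture_nnsfun (f : {nnsfun Z >-> R}) :
  \int[nu]_z (f z)%:E = \int[m]_y \int[q y]_z (f z)%:E.
Proof.
rewrite integral_nnsfunE; under [RHS]eq_integral do rewrite integral_nnsfunE.
rewrite ge0_integral_fsum//; last 2 first.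
- by move=> r; apply: measurable_funeM; exact: mq.
- move=> r y _; apply: (mulemu_ge0 (fun r => f @^-1` [set r])).
  exact: preimage_nnfun0.
apply: eq_fsbigr => r _; rewrite nuE//.
have [r0|r0] := leP 0%R r; first by rewrite ge0_integralZl//; exact: mq.
rewrite [RHS]integral0_eq => [|y _]; last by rewrite preimage_nnfun0// measure0 mule0.
by rewrite integral0_eq ?mule0// => y _; rewrite preimage_nnfun0// measure0.
Qed.

(** The passage from sets to functions, made once for its three uses: measures
    with a density, the Metropolis kernel (a mixture over the proposal) and
    invariance (a mixture over the starting point). *)
Lemma integral_mixture (h : Z -> \bar R) :
  (forall z, 0 <= h z) -> measurable_fun setT h ->
  \int[nu]_z h z = \int[m]_y \int[q y]_z h z.
Proof.
move=> h0 mh; pose f := nnsfun_approx measurableT mh.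
have cvgf (k : {measure set Z -> \bar R}) :
    \int[k]_z h z = limn (fun n => \int[k]_z (f n z)%:E).
  rewrite -monotone_convergence//.
  - by apply: eq_integral => z _; apply/esym/cvg_lim => //; exact: cvg_nnsfun_approx.
  - by move=> n; exact/measurable_EFinP.
  - by move=> n z _; rewrite lee_fin.
  - by move=> z _ a b ab; rewrite lee_fin; exact/lefP/nd_nnsfun_approx.
rewrite cvgf; under [in LHS]eq_fun do rewrite integral_mixture_nnsfun.
rewrite -monotone_convergence//.
- by apply: eq_integral => y _; rewrite cvgf.
- move=> n; apply: measurable_fun_integral_kernel => //.
    by move=> z; rewrite lee_fin.
  exact/measurable_EFinP.
- by move=> n y _; apply: integral_ge0 => z _; rewrite lee_fin.
- move=> y _ a b ab; apply: ge0_le_integral => //.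
  + by move=> z _; rewrite lee_fin.
  + exact/measurable_EFinP.
  + exact/measurable_EFinP.
  + by move=> z _; rewrite lee_fin; exact/lefP/nd_nnsfun_approx.
Qed.

Lemma Rintegral_mixture (h : Z -> R) B : m setT = 1 -> nu setT = 1 ->
  (forall y, q y setT = 1) -> measurable_fun setT h -> (forall z, `|h z| <= B)%R ->
  (\int[nu]_z h z = \int[m]_y \int[q y]_z h z)%R.
Proof.
move=> m1 nu1 q1 mh hB.
have hi (k : {measure set Z -> \bar R}) : k setT = 1 -> k.-integrable setT (EFin \o h).
  by move=> k1; exact: (integrable_bounded k1 mh hB).
have mqh := measurable_kernel_Rintegral mq q1 mh hB.
have qhB y : (`|\int[q y]_z h z| <= B)%R by exact: ler_norm_Rintegral.
apply: (@addIr _ B); rewrite -!RintegralDcst//; [|exact: (integrable_bounded m1 mqh qhB)|exact: hi].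
rewrite /Rintegral integral_mixture//; last 2 first.
- by move=> z; rewrite lee_fin -lerBlDr sub0r; have := hB z; rewrite ler_norml => /andP[].
- by apply/measurable_EFinP; exact: measurable_funD.
congr fine; apply: eq_integral => y _.
rewrite -EFin_Rintegral ?RintegralDcst//; first exact: hi.
have hDB z : (`|h z + B| <= B + `|B|)%R by rewrite (le_trans (ler_normD _ _))// lerD2r.
by apply: (integrable_bounded _ _ hDB) => //; exact: measurable_funD.
Qed.

End mixture.

(** The measure with density [f] is the mixture of the Dirac masses [f x * delta_x]. *)
Lemma integral_has_density d (S : measurableType d) (R : realType)
    (m : {measure set S -> \bar R}) (nu : probability S R) (f : S -> R)
    (h : S -> \bar R) :
  measurable_fun setT f -> (forall x, 0 <= f x) -> has_density m nu f ->
  measurable_fun setT h -> (forall x, (0 <= h x)%E) ->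
  (\int[nu]_x h x = \int[m]_x ((f x)%:E * h x))%E.
Proof.
move=> mf f0 nuE mh h0.
pose q x : {measure set S -> \bar R} := mscale (NngNum (f0 x)) \d_x.
have qE x A : (q x A = (f x)%:E * \d_x A)%E by [].
rewrite (integral_mixture (m := m) (nu := nu) (q := q))//.
- apply: eq_integral => x _; rewrite ge0_integral_mscale//=.
  by rewrite integral_dirac// diracT mul1e.
- move=> U mU; apply: emeasurable_funM; first exact/measurable_EFinP.
  exact: measurable_fun_dirac.
- move=> A mA; rewrite [LHS](nuE _ mA) integral_mkcond; apply: eq_integral => x _.
  rewrite qE diracE patchE; case: ifPn => xA; by rewrite ?mule1 ?mule0.
Qed.

(** * Harris' theorem *)

Section Harris.
Context d (S : measurableType d) (R : realType) (Q : R.-pker S ~> S).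
Implicit Types f : S -> R.

Definition kernel_op f : S -> R := fun x => \int[Q x]_y f y.

Lemma kernel_op_measurable f B : measurable_fun setT f -> (forall x, `|f x| <= B) ->
  measurable_fun setT (kernel_op f).
Proof.
move=> mf fB; apply: (measurable_kernel_Rintegral _ _ mf fB).
  exact: measurable_kernel.
by move=> x; exact: prob_kernel.
Qed.

Lemma kernel_op_bounded f B : measurable_fun setT f -> (forall x, `|f x| <= B) ->
  forall x, `|kernel_op f x| <= B.
Proof. by move=> mf fB x; apply: ler_norm_Rintegral => //; exact: prob_kernel. Qed.

Lemma iter_kernel_op f B n : measurable_fun setT f -> (forall x, `|f x| <= B) ->
  measurable_fun setT (iter n kernel_op f) /\ forall x, `|iter n kernel_op f x| <= B.
Proof.
move=> mf fB; elim: n => [//|n [mn nB]] /=; split.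
  exact: kernel_op_measurable nB.
exact: kernel_op_bounded.
Qed.

Lemma minorized_integral (nu : probability S R) delta x (h : S -> \bar R) :
  0 <= delta ->
  (forall A, measurable A -> (delta%:E * nu A <= Q x A)%E) ->
  measurable_fun setT h -> (forall y, 0 <= h y)%E ->
  (delta%:E * \int[nu]_y h y <= \int[Q x]_y h y)%E.
Proof.
move=> d0 minor mh h0.
rewrite -(@ge0_integral_mscale _ _ _ nu _ measurableT (NngNum d0))//.
by apply: ge0_le_measure_integral => // A mA _; exact: minor.
Qed.

(** Stands in for the coupling in the proof of Harris' theorem. Subtracting the
    common part [delta nu] from both laws would give residual measures that have
    to be built; integrating the nonnegative [g] and [h] against [delta nu] alone
    yields the same gain. *)
Lemma common_mass (nu : probability S R) (delta c : R) (x y : S) (g h : S -> R) :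
  0 <= delta -> 0 <= c ->
  (forall A, measurable A -> (delta%:E * nu A <= Q x A)%E) ->
  (forall A, measurable A -> (delta%:E * nu A <= Q y A)%E) ->
  measurable_fun setT g -> measurable_fun setT h ->
  (forall z, 0 <= g z) -> (forall z, 0 <= h z) -> (forall z, 2 * c <= g z + h z) ->
  ((delta * (2 * c))%:E <= \int[Q x]_z (g z)%:E + \int[Q y]_z (h z)%:E)%E.
Proof.
move=> d0 c0 minx miny mg mh g0 h0 gh.
apply: (@le_trans _ _ (delta%:E * \int[nu]_z (g z)%:E + delta%:E * \int[nu]_z (h z)%:E)%E).
  rewrite -ge0_muleDr; first last.
  - by apply: integral_ge0 => z _; rewrite lee_fin.
  - by apply: integral_ge0 => z _; rewrite lee_fin.
  rewrite -ge0_integralD//; first last.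
  - exact/measurable_EFinP.
  - by move=> z _; rewrite lee_fin.
  - exact/measurable_EFinP.
  - by move=> z _; rewrite lee_fin.
  rewrite EFinM lee_wpmul2l// ?lee_fin//.
  have <- : (\int[nu]_z (2 * c)%:E = (2 * c)%:E)%E.
    by rewrite integral_cst//= (probability_setT nu) mule1.
  apply: ge0_le_integral => //.
  - by move=> z _; rewrite lee_fin mulr_ge0.
  - by apply/measurable_EFinP; exact: measurable_funD.
  - by move=> z _; rewrite -EFinD lee_fin.
apply: leeD; apply: minorized_integral => //; exact/measurable_EFinP.
Qed.

Variables (W : S -> R) (rho B : R).
Hypotheses (mW : measurable_fun setT W) (W0 : forall x, 0 <= W x).
Hypotheses (rho0 : 0 <= rho) (rho1 : rho < 1) (B0 : 0 <= B).
Hypothesis drift : forall x, (\int[Q x]_y (W y)%:E <= (rho * W x + B)%:E)%E.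

Let integrableW x : (Q x).-integrable setT (EFin \o W).
Proof.
apply/integrableP; split; first exact/measurable_EFinP.
under eq_integral do rewrite gee0_abs ?lee_fin//.
exact: le_lt_trans (drift x) (ltry _).
Qed.

Let integralW x : \int[Q x]_y W y <= rho * W x + B.
Proof. by rewrite -lee_fin EFin_Rintegral. Qed.

Let integral_weight x f M c K eta : measurable_fun setT f -> (forall x, `|f x| <= M) ->
  0 <= K -> 0 <= eta ->
  (\int[Q x]_y (K * (1 + eta * W y) + c * f y)%:E =
   (K * (1 + eta * \int[Q x]_y W y) + c * kernel_op f x)%:E)%E.
Proof.
move=> mf fM K0 eta0.
have q1 : Q x setT = 1%E by exact: prob_kernel.
have fi := integrable_bounded q1 mf fM.
have iZ r h : (Q x).-integrable setT (EFin \o h) ->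
    (Q x).-integrable setT (EFin \o (fun y => r * h y)).
  by move=> ih; exact: (integrableZl measurableT r ih).
have iD h1 h2 : (Q x).-integrable setT (EFin \o h1) ->
    (Q x).-integrable setT (EFin \o h2) ->
    (Q x).-integrable setT (EFin \o (fun y => h1 y + h2 y)).
  by move=> i1 i2; exact: (integrableD measurableT i1 i2).
have i1 : (Q x).-integrable setT (EFin \o (fun=> 1)) by exact: integrable_cst.
have iV := iD _ _ i1 (iZ eta _ (integrableW x)).
rewrite -EFin_Rintegral; last exact: iD (iZ _ _ iV) (iZ _ _ fi).
congr EFin.
rewrite (RintegralD measurableT (iZ _ _ iV) (iZ _ _ fi)).
rewrite (RintegralZl _ measurableT iV)// (RintegralZl _ measurableT fi)//.
rewrite (RintegralD measurableT i1 (iZ _ _ (integrableW x))).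
by rewrite (RintegralZl _ measurableT (integrableW x))// Rintegral_cst_prob.
Qed.

(** Take for [c] the supremum of [u - w]: this is why the weighted oscillation of
    a function is its weighted distance to the constants. *)
Lemma oscillation_center (T : Type) (u w : T -> R) :
  (forall x y, u x - u y <= w x + w y) -> exists c, forall x, `|u x - c| <= w x.
Proof.
move=> uw; have [[x0 _]|] := pselect (exists x : T, True); last first.
  by move=> noT; exists 0 => x; exfalso; apply: noT; exists x.
pose A := range (fun x => u x - w x).
have ubA y : ubound A (u y + w y).
  by move=> _ [x _ <-]; have := uw x y; lra.
have supA : has_sup A by split; [exists (u x0 - w x0), x0 | exists (u x0 + w x0)].
exists (sup A) => x.
have : sup A <= u x + w x by apply: ge_sup => //; case: supA.
have : u x - w x <= sup A by apply: ub_le_sup; [case: supA | exists x].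
by rewrite ler_norml; lra.
Qed.

Hypothesis small : forall r, small1 Q [set x | W x <= r].

(** Hairer and Mattingly's form of Harris' theorem: the oscillation of [f] is
    measured with the weight [1 + eta W]. Where [W x + W y] is large the drift
    shrinks the weight by itself. Elsewhere both points lie in a small set, and
    [eta] is so small that the mass [2 delta] gained there beats the drift
    constant [2 eta B]. *)
Lemma harris_contraction : exists kappa eta : R, [/\ 0 <= kappa < 1, 0 <= eta &
  forall (f : S -> R) M K c, measurable_fun setT f -> (forall x, `|f x| <= M) ->
    0 <= K -> (forall x, `|f x - c| <= K * (1 + eta * W x)) ->
    exists c', forall x, `|kernel_op f x - c'| <= kappa * K * (1 + eta * W x)].
Proof.
move: (rho0) (rho1) (B0) => rho_ge0 rho_lt1 B_ge0.
have rho1' : 0 < 1 - rho by rewrite subr_gt0.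
(* beyond this level half of the drift [(1 - rho) s] exceeds [2 B] *)
pose r0 := 4 * (B + 1) / (1 - rho).
have [delta0 delta0_gt0 [nu minor0]] := small r0.
pose delta := Num.min delta0 1.
have delta_gt0 : 0 < delta by rewrite lt_min delta0_gt0 ltr01.
have delta_le1 : delta <= 1 by rewrite ge_min lexx orbT.
have minor x : W x <= r0 -> forall A, measurable A -> (delta%:E * nu A <= Q x A)%E.
  move=> xr A mA; apply: le_trans (minor0 x A xr mA).
  by rewrite lee_wpmul2r// lee_fin ge_min lexx.
(* small enough for [2 eta B <= delta] *)
pose eta := delta / (2 * (B + 1)).
have B1 : 0 < 2 * (B + 1) by lra.
have etaE : eta * (2 * (B + 1)) = delta by rewrite divfK// gt_eqF.
have r0E : r0 * (1 - rho) = 4 * (B + 1) by rewrite divfK// gt_eqF.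
have eta0 : 0 <= eta by rewrite divr_ge0// ltW.
clearbody eta r0 delta.
pose eps := delta * (1 - rho) / 4.
have eps1 : 4 * eps <= delta by rewrite /eps; nra.
have eps2 : 4 * eps <= 1 - rho by rewrite /eps; nra.
have eps0 : 0 < eps by rewrite /eps; nra.
clearbody eps.
exists (1 - eps), eta; split=> //; first by apply/andP; split; lra.
move=> f M K c mf fM K0 fK; apply: oscillation_center => x y.
set s := W x + W y; have s0 : 0 <= s by rewrite addr_ge0.
have etas : 0 <= eta * s by rewrite mulr_ge0.
(* [D] is the mass gained from the minorization: none off the small set *)
suff [D DK Ds] : exists2 D,
    D * K <= K * (2 + eta * (rho * s + 2 * B)) - (kernel_op f x - kernel_op f y) &
    2 + eta * (rho * s + 2 * B) - D <= (1 - eps) * (2 + eta * s).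
  have := ler_wpM2l K0 Ds.
  by rewrite /s in DK Ds *; lra.
have intx := integral_weight x (M := M) (f := f).
pose g z := K * (1 + eta * W z) - (f z - c).
pose h z := K * (1 + eta * W z) + (f z - c).
have mg : measurable_fun setT g.
  by apply: measurable_funB; [do 2! [apply: measurable_funM => //; try apply: measurable_funD => //]|apply: measurable_funB].
have mh : measurable_fun setT h.
  by apply: measurable_funD; [do 2! [apply: measurable_funM => //; try apply: measurable_funD => //]|apply: measurable_funB].
have g0 z : 0 <= g z by have := fK z; rewrite ler_norml /g; lra.
have h0 z : 0 <= h z by have := fK z; rewrite ler_norml /h; lra.
have gh z : 2 * K <= g z + h z.
  have : 0 <= K * (eta * W z) by rewrite !mulr_ge0.
  by rewrite /g /h; lra.
have fcM z : `|f z - c| <= M + `|c| by rewrite (le_trans (ler_normB _ _))// lerD2r.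
have mfc : measurable_fun setT (fun z => f z - c) by exact: measurable_funB.
have opc z : kernel_op (fun z => f z - c) z = kernel_op f z - c.
  apply: RintegralDcst; first exact: prob_kernel.
  by apply: integrable_bounded mf fM; exact: prob_kernel.
have ghE : (\int[Q x]_z (g z)%:E + \int[Q y]_z (h z)%:E <=
   (K * (2 + eta * (rho * s + 2 * B)) - (kernel_op f x - kernel_op f y))%:E)%E.
  have := @integral_weight x _ _ (-1) K eta mfc fcM K0 eta0.
  under eq_integral do rewrite mulN1r.
  move=> ->.
  have := @integral_weight y _ _ 1 K eta mfc fcM K0 eta0.
  under eq_integral do rewrite mul1r.
  move=> ->.
  rewrite -EFinD lee_fin !opc.
  have := ler_wpM2l K0 (ler_wpM2l eta0 (lerD (integralW x) (integralW y))).
  by rewrite /s; lra.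
have [sr|rs] := leP s r0; last first.
  exists 0.
    rewrite mul0r -lee_fin (le_trans _ ghE)// adde_ge0//; apply: integral_ge0 => z _;
    by rewrite lee_fin.
  have : eta * (4 * (B + 1)) <= eta * ((1 - rho) * s).
    by rewrite ler_wpM2l// -r0E mulrC ler_wpM2l ?ltW.
  have : 0 <= (1 - rho - 4 * eps) * (eta * s) by rewrite mulr_ge0// subr_ge0.
  by nra.
exists (2 * delta).
  rewrite -lee_fin (le_trans _ ghE)//.
  have -> : 2 * delta * K = delta * (2 * K) by ring.
  apply: (common_mass (nu := nu)) => //; first exact: ltW.
  - by apply: minor; rewrite (le_trans _ sr)// lerDl.
  - by apply: minor; rewrite (le_trans _ sr)// lerDr.
have : 0 <= (1 - rho - 4 * eps) * (eta * s) by rewrite mulr_ge0// subr_ge0.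
have : eta * (2 * B) <= delta by rewrite -etaE ler_wpM2l//; lra.
by nra.
Qed.

(** The centres [c] are left unidentified: they cancel when two laws, here that of
    the process and the stationary one, are compared. *)
Lemma harris_ergodic : exists kappa eta : R, [/\ 0 <= kappa < 1, 0 <= eta &
  forall (f : S -> R) M n, measurable_fun setT f -> (forall x, `|f x| <= M) -> 0 <= M ->
    exists c, forall x, `|iter n kernel_op f x - c| <= kappa ^+ n * M * (1 + eta * W x)].
Proof.
have [kappa [eta [k01 eta0 contr]]] := harris_contraction.
exists kappa, eta; split=> // f M n mf fM M0.
elim: n => [|n [c ih]] /=.
  exists 0 => x; rewrite subr0 mul1r (le_trans (fM x))// ler_peMr//.
  by rewrite lerDl mulr_ge0.
have [mn nM] := iter_kernel_op n mf fM.
rewrite exprS -[kappa * _ * M]mulrA; apply: (contr _ M) => //.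
by rewrite mulr_ge0// exprn_ge0//; case/andP: k01.
Qed.

End Harris.

(** * The interacting tempering kernel *)

Section clipped_ratio.
Context (R : realType).

Lemma clip_lipschitz (u a a' : R) : 0 <= u -> 0 < a -> 0 < a' ->
  `|Num.min 1 (u / a) - Num.min 1 (u / a')| <= `|a - a'| / a'.
Proof.
(* for [b <= c], [min 1 (u / c) >= (b / c) * min 1 (u / b)] *)
suff main (b c : R) : 0 <= u -> 0 < b -> b <= c ->
    0 <= Num.min 1 (u / b) - Num.min 1 (u / c) <= (c - b) / c.
  move=> u0 a0 a'0; have [aa'|/ltW a'a] := leP a a'.
    by have /andP[? ?] := main _ _ u0 a0 aa'; rewrite ger0_norm// ler0_norm ?subr_le0// opprB.
  have /andP[h1 h2] := main _ _ u0 a'0 a'a.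
  rewrite distrC ger0_norm// ger0_norm ?subr_ge0// (le_trans h2)//.
  by rewrite ler_wpM2l ?subr_ge0// lef_pV2.
move=> u0 b0 bc; have c0 : 0 < c by exact: lt_le_trans bc.
have ucb : u / c <= u / b by rewrite ler_wpM2l// lef_pV2.
have -> : (c - b) / c = 1 - b / c by rewrite mulrBl divff// gt_eqF.
have t0 : 0 <= u / b by rewrite divr_ge0// ltW.
have ucE : u / c = u / b * (b / c) by rewrite mulrA divfK// gt_eqF.
have r0 : 0 <= b / c by rewrite divr_ge0// ltW.
have r1 : b / c <= 1 by rewrite ler_pdivrMr// mul1r.
rewrite ucE; move: (u / b) (b / c) t0 r0 r1 => t r t0 r0 r1.
by rewrite /Num.min; case: ifPn; case: ifPn; rewrite -?leNgt; nra.
Qed.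

End clipped_ratio.

Section tempering_kernel.
Context d (S : measurableType d) (R : realType).
Variables (p : {mfun S >-> R}) (beta : R).

Local Notation alpha := (acceptance p beta).

Lemma norm_acceptance x y : `|alpha x y| <= 1.
Proof. by rewrite ger0_norm ?acceptance_ge0// acceptance_le1. Qed.

Lemma rejection_ge0 x y : 0 <= 1 - alpha x y.
Proof. by rewrite subr_ge0 acceptance_le1. Qed.

Lemma measurable_acceptancer x : measurable_fun setT (alpha x).
Proof. exact: (measurableT_comp (measurable_acceptance p beta) (pair1_measurable x)). Qed.

Variables (P : R.-pker S ~> S) (v : R) (v01 : 0 < v < 1).

Section one_theta.
Variable theta : probability S R.

(** The law of the next state given the proposal [y]. *)
Let move x y : {measure set S -> \bar R} := measure_add
  (mscale (NngNum (acceptance_ge0 p beta x y)) \d_y)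
  (mscale (NngNum (rejection_ge0 x y)) \d_x).

Let moveE x y A : (move x y A = (alpha x y)%:E * \d_y A + (1 - alpha x y)%:E * \d_x A)%E.
Proof. exact: measure_addE. Qed.

Let mEalpha x : measurable_fun setT (fun y => (alpha x y)%:E).
Proof. by apply/measurable_EFinP; exact: measurable_acceptancer. Qed.

Let mErej x : measurable_fun setT (fun y => (1 - alpha x y)%:E).
Proof. by apply/measurable_EFinP; apply: measurable_funB => //; exact: measurable_acceptancer. Qed.

Lemma integral_Kkernel x (h : S -> \bar R) :
  measurable_fun setT h -> (forall y, (0 <= h y)%E) ->
  (\int[Kkernel p beta theta x]_y h y =
   \int[theta]_y ((alpha x y)%:E * h y + (1 - alpha x y)%:E * h x))%E.
Proof.
move=> mh h0; rewrite (integral_mixture (m := theta) (q := move x))//.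
- apply: eq_integral => y _; rewrite ge0_integral_measure_add//.
  by rewrite !ge0_integral_mscale//= !integral_dirac// !diracT !mul1e.
- move=> U mU; under eq_fun do rewrite moveE.
  apply: emeasurable_funD; apply: emeasurable_funM => //.
  exact: measurable_fun_dirac.
- move=> A mA; under eq_integral do rewrite moveE.
  rewrite ge0_integralD//; first last.
  + by apply: emeasurable_funM.
  + by move=> y _; rewrite mule_ge0// lee_fin rejection_ge0.
  + by apply: emeasurable_funM => //; exact: measurable_fun_dirac.
  + by move=> y _; rewrite mule_ge0// lee_fin acceptance_ge0.
  rewrite ge0_integralZr//; last by move=> y _; rewrite lee_fin rejection_ge0.
  rewrite /Kkernel /= /Ktheta muleC; congr (_ + _)%E.
  rewrite integral_mkcond; apply: eq_integral => y _.
  by rewrite diracE patchE; case: ifPn => yA; rewrite ?mule1 ?mule0.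
Qed.

Lemma integral_Ptheta x (h : S -> \bar R) :
  measurable_fun setT h -> (forall y, (0 <= h y)%E) ->
  (\int[Ptheta p beta theta P v01 x]_y h y = (1 - v)%:E * \int[P x]_y h y
   + v%:E * \int[theta]_y ((alpha x y)%:E * h y + (1 - alpha x y)%:E * h x))%E.
Proof.
move=> mh h0; rewrite ge0_integral_measure_add// !ge0_integral_mscale//=.
by rewrite integral_Kkernel.
Qed.

Lemma PthetaT x : Ptheta p beta theta P v01 x setT = 1%E.
Proof. exact: prob_kernel. Qed.

Lemma Rintegral_Ptheta x (g : S -> R) B :
  measurable_fun setT g -> (forall y, `|g y| <= B) ->
  \int[Ptheta p beta theta P v01 x]_y g y = (1 - v) * \int[P x]_y g y
   + v * (g x + \int[theta]_y (alpha x y * (g y - g x))).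
Proof.
move=> mg gB.
have P1 : P x setT = 1%E by exact: prob_kernel.
have th1 : theta setT = 1%E by exact: probability_setT.
have gB2 y : `|g y - g x| <= B + B by rewrite (le_trans (ler_normB _ _))// lerD.
have mag : measurable_fun setT (fun y => alpha x y * (g y - g x)).
  by apply: measurable_funM; [exact: measurable_acceptancer|exact: measurable_funB].
have agB y : `|alpha x y * (g y - g x)| <= B + B.
  rewrite normrM (le_trans _ (gB2 y))// ler_piMl//; exact: norm_acceptance.
have iag := integrable_bounded th1 mag agB.
have mgB : measurable_fun setT (fun y => g y + B) by exact: measurable_funD.
have gB0 y : 0 <= g y + B by have := gB y; rewrite ler_norml => /andP[]; lra.
apply: (@addIr _ B).
rewrite -RintegralDcst; last 2 first.
- exact: PthetaT.
- by apply: integrable_bounded mg gB; exact: PthetaT.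
apply: EFin_inj; rewrite EFin_Rintegral; last first.
  apply: (integrable_bounded (PthetaT x) mgB (B := B + `|B|)) => y.
  by rewrite (le_trans (ler_normD _ _))// lerD2r.
rewrite integral_Ptheta;
  [|exact/measurable_EFinP|by move=> y; rewrite lee_fin].
rewrite -EFin_Rintegral; last first.
  apply: (integrable_bounded P1 mgB (B := B + `|B|)) => y.
  by rewrite (le_trans (ler_normD _ _))// lerD2r.
rewrite RintegralDcst//; last exact: integrable_bounded mg gB.
under eq_integral => y _.
  rewrite -!EFinM -EFinD.
  have -> : alpha x y * (g y + B) + (1 - alpha x y) * (g x + B) =
            alpha x y * (g y - g x) + (g x + B) by ring.
  over.
rewrite -EFin_Rintegral; last first.
  apply: (integrable_bounded th1 _ (B := B + B + `|g x + B|)) => [|y].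
    exact: measurable_funD.
  by rewrite (le_trans (ler_normD _ _))// lerD2r.
rewrite RintegralDcst// -!EFinM -EFinD; congr EFin; ring.
Qed.

(** Accepted moves contribute at most [theta W] since [alpha <= 1], and the rest
    of the kernel leaves [W] where it is. *)
Lemma drift_Ptheta (W : S -> R) lambda b x : measurable_fun setT W ->
  (forall y, 0 <= W y) ->
  (\int[P x]_y (W y)%:E <= (lambda * W x + b)%:E)%E ->
  (\int[Ptheta p beta theta P v01 x]_y (W y)%:E <=
   (((1 - v) * lambda + v) * W x + (1 - v) * b)%:E + v%:E * \int[theta]_y (W y)%:E)%E.
Proof.
move=> mW W0 drift; have /andP[v0 v1] := v01.
have v1' : 0 <= 1 - v by lra.
have mEW : measurable_fun setT (EFin \o W) by exact/measurable_EFinP.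
rewrite integral_Ptheta//.
apply: (@le_trans _ _ ((1 - v)%:E * (lambda * W x + b)%:E
    + v%:E * (\int[theta]_y (W y)%:E + (W x)%:E))%E).
  apply: leeD; first by rewrite lee_wpmul2l// lee_fin.
  apply: lee_wpmul2l; first by rewrite lee_fin ltW.
  have WE : ((W x)%:E = \int[theta]_y (W x)%:E)%E.
    by rewrite integral_cst//= (probability_setT theta) mule1.
  rewrite [X in (_ <= _ + X)%E]WE.
  rewrite -ge0_integralD//; last 2 first.
  - by move=> y _; rewrite lee_fin.
  - by move=> y _; rewrite lee_fin.
  apply: ge0_le_integral => //.
  - by move=> y _; rewrite adde_ge0 ?mule_ge0 ?lee_fin ?acceptance_ge0 ?rejection_ge0.
  - apply: emeasurable_funD; apply: emeasurable_funM => //.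
  - exact: emeasurable_funD.
  - move=> y _; rewrite -!EFinM -!EFinD lee_fin lerD//.
      by rewrite ler_piMl ?acceptance_le1.
    by rewrite ler_piMl// gerBl acceptance_ge0.
rewrite ge0_muleDr ?lee_fin//; last by apply: integral_ge0 => y _; rewrite lee_fin.
rewrite [(v%:E * _ + _)%E]addeC addeA leeD2r// -!EFinM -EFinD lee_fin.
by rewrite le_eqVlt; apply/orP; left; apply/eqP; ring.
Qed.

Lemma small_Ptheta C : small1 P C -> small1 (Ptheta p beta theta P v01) C.
Proof.
move=> [delta delta0 [nu minor]]; have /andP[v0 v1] := v01.
exists ((1 - v) * delta); first by rewrite mulr_gt0// subr_gt0.
exists nu => x A Cx mA; rewrite [leRHS]PthetaE EFinM -muleA.
rewrite -[leLHS]adde0; apply: leeD.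
  by rewrite lee_wpmul2l ?minor// lee_fin subr_ge0 ltW.
apply: mule_ge0; first by rewrite lee_fin ltW.
exact: (measure_ge0 (Kkernel p beta theta x)).
Qed.

End one_theta.

(** Detailed balance: with [theta = c p^-beta Pi], the flow
    [alpha x y * c p(y)^-beta = c min (p(y)^-beta) (p(x)^-beta)] is symmetric. *)
Lemma invariant_Ptheta (Pi theta : probability S R) c :
  (forall x, 0 < p x) -> 0 <= c ->
  has_density Pi theta (fun x => c * p x `^ (- beta)) ->
  invariant_for P Pi -> invariant_for (Ptheta p beta theta P v01) Pi.
Proof.
move=> p0 c0 thetaE invP A mA; have /andP[v0 v1] := v01.
have mdens : measurable_fun setT (fun x => c * p x `^ (- beta)).
  apply: measurable_funM => //.
  exact: (measurableT_comp (measurable_powR (- beta)) (measurable_funPT p)).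
have dens0 x : 0 <= c * p x `^ (- beta) by rewrite mulr_ge0// powR_ge0.
pose flow (z : S * S) := ((c * p z.2 `^ (- beta)) * alpha z.1 z.2)%R.
have flow0 z : 0 <= flow z by rewrite mulr_ge0// acceptance_ge0.
have mflow : measurable_fun setT flow.
  apply: measurable_funM; last exact: measurable_acceptance.
  by apply: (measurableT_comp mdens); exact: measurable_snd.
have flow_sym x y : flow (x, y) = flow (y, x).
  have pw z : 0 < p z `^ beta by rewrite powR_gt0.
  rewrite /flow /acceptance /= !powRN -!mulrA; congr (_ * _).
  move: (p x `^ beta) (p y `^ beta) (pw x) (pw y) => a b a0 b0.
  rewrite !minr_pMr ?invr_ge0 ?(ltW a0) ?(ltW b0)// !mulr1.
  by rewrite !mulrA mulVf ?gt_eqF// mulVf ?gt_eqF// !mul1r minC.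
pose mI := measurable_indic mA : measurable_fun setT (\1_A : S -> R).
have intK x : (Ktheta p beta theta x A =
    \int[Pi]_y (flow (x, y) * \1_A y)%:E
    + \d_x A * \int[theta]_y (1 - alpha x y)%:E)%E.
  rewrite /Ktheta; congr (_ + _)%E; rewrite integral_mkcond.
  rewrite (@integral_has_density _ _ _ Pi _ _ _ mdens dens0 thetaE).
  - apply: eq_integral => y _; rewrite patchE indicE.
    by case: ifPn => yA; rewrite -EFinM ?mulr1 ?mulr0.
  - apply/(measurable_restrictT _ _).1 => //; apply: measurable_funTS.
    by apply/measurable_EFinP; exact: measurable_acceptancer.
  - by move=> y; rewrite patchE; case: ifP => // _; rewrite lee_fin acceptance_ge0.
have mEflow : measurable_fun setT (EFin \o flow) by exact/measurable_EFinP.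
have mflowr x : measurable_fun setT (fun y => (flow (x, y))%:E).
  exact: (measurableT_comp mEflow (pair1_measurable x)).
have mEalpha x : measurable_fun setT (fun y => (alpha x y)%:E).
  by apply/measurable_EFinP; exact: measurable_acceptancer.
have mErej : measurable_fun setT (fun x => \int[theta]_y (1 - alpha x y)%:E)%E.
  apply: (@measurable_fun_fubini_tonelli_F _ _ _ _ _ theta
    (fun z => (1 - alpha z.1 z.2)%:E)).
    by apply/measurable_EFinP; apply: measurable_funB => //; exact: measurable_acceptance.
  by move=> z; rewrite lee_fin rejection_ge0.
have rej0 x : (0 <= \int[theta]_y (1 - alpha x y)%:E)%E.
  by apply: integral_ge0 => y _; rewrite lee_fin rejection_ge0.
have flowA0 z : (0 <= (flow z * \1_A z.2)%:E)%E by rewrite lee_fin mulr_ge0.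
have mflowA : measurable_fun setT (fun z : S * S => (flow z * \1_A z.2)%:E).
  apply/measurable_EFinP; apply: measurable_funM => //.
  by apply: (measurableT_comp mI); exact: measurable_snd.
have invK : (\int[Pi]_x Ktheta p beta theta x A = Pi A)%E.
  under eq_integral do rewrite intK.
  rewrite ge0_integralD//; first last.
  - by apply: emeasurable_funM => //; exact: measurable_fun_dirac.
  - by move=> x _; rewrite mule_ge0.
  - exact: (measurable_fun_fubini_tonelli_F (m2 := Pi) _ mflowA).
  - by move=> x _; apply: integral_ge0 => y _; exact: (flowA0 (x, y)).
  rewrite (fubini_tonelli (m1 := Pi) (m2 := Pi) (fun z => (flow z * \1_A z.2)%:E))//=.
  rewrite -ge0_integralD//; first last.
  - by apply: emeasurable_funM => //; exact: measurable_fun_dirac.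
  - by move=> x _; rewrite mule_ge0.
  - exact: (measurable_fun_fubini_tonelli_G (m1 := Pi) _ mflowA).
  - by move=> y _; apply: integral_ge0 => x _; exact: (flowA0 (x, y)).
  transitivity (\int[Pi]_x (\1_A x)%:E)%E; last by rewrite integral_indic// setIT.
  apply: eq_integral => x _.
  rewrite diracE indicE; case: (boolP (x \in A)) => xA /=; last first.
    by rewrite mul0e adde0 integral0_eq// => y _; rewrite mulr0.
  under eq_integral do rewrite mulr1 flow_sym.
  rewrite mul1e; under eq_integral do rewrite /flow EFinM /=.
  rewrite -(@integral_has_density _ _ _ Pi _ _ _ mdens dens0 thetaE)//; last first.
    by move=> y; rewrite lee_fin acceptance_ge0.
  rewrite -ge0_integralD//; first last.
  - by apply/measurable_EFinP; apply: measurable_funB => //; exact: measurable_acceptancer.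
  - by move=> y _; rewrite lee_fin rejection_ge0.
  - by move=> y _; rewrite lee_fin acceptance_ge0.
  under eq_integral do rewrite -EFinD subrKC.
  by rewrite integral_cst// mul1e; exact: (probability_setT theta).
have mPA : measurable_fun setT (fun x => P x A) by exact: measurable_kernel.
have mKA : measurable_fun setT (fun x => Ktheta p beta theta x A).
  exact: (measurable_kernel (Kkernel p beta theta)).
have K0 x : (0 <= Ktheta p beta theta x A)%E by exact: (measure_ge0 (Kkernel p beta theta x)).
under eq_integral do rewrite PthetaE.
rewrite ge0_integralD//; first last.
- exact: measurable_funeM.
- by move=> x _; rewrite mule_ge0 ?lee_fin ?(ltW v0).
- exact: measurable_funeM.
- by move=> x _; rewrite mule_ge0 ?lee_fin ?subr_ge0 ?(ltW v1).
rewrite !ge0_integralZl// ?lee_fin ?subr_ge0 ?(ltW v0) ?(ltW v1)//.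
by rewrite invK invP// -ge0_muleDl ?lee_fin ?subr_ge0 ?(ltW v0) ?(ltW v1)// -EFinD subrK mul1e.
Qed.

End tempering_kernel.

Lemma continuous_borel_measurable (R : realType) d (E : polishType R d) (f : E -> R) :
  continuous f -> measurable_fun setT f.
Proof.
move=> cf; apply: (measurability _ (RGenOpens.measurableE R)) => _ [_ [a [b ->] <-]].
rewrite setTI measurable_borel; apply: sub_sigma_algebra.
by move/continuousP : cf; apply; exact: interval_open.
Qed.

Section clipped_integral.
Context d (S : measurableType d) (R : realType).

(** At a point [x] the tempering move integrates this function with
    [a = p x `^ beta] and [c = g x]. The Lipschitz bound in [a], uniform in [c],
    gives both the Feller property and the reduction of the law of large numbers
    to finitely many values of [a]. *)
Lemma clipped_integral_lipschitz (m : {measure set S -> \bar R}) (u g : S -> R) B a a' c :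
  m setT = 1%E -> measurable_fun setT u -> (forall y, 0 <= u y) ->
  measurable_fun setT g -> (forall y, `|g y| <= B) -> `|c| <= B -> 0 < a -> 0 < a' ->
  `|\int[m]_y (Num.min 1 (u y / a) * (g y - c)) -
    \int[m]_y (Num.min 1 (u y / a') * (g y - c))| <= `|a - a'| / a' * (2 * B).
Proof.
move=> m1 mu u0 mg gB cB a0 a'0.
have mc b : measurable_fun setT (fun y => Num.min 1 (u y / b)).
  by apply: measurable_minr => //; exact: measurable_funM.
have mgc : measurable_fun setT (fun y => g y - c) by exact: measurable_funB.
have gcB y : `|g y - c| <= 2 * B.
  by rewrite (le_trans (ler_normB _ _))// mulr_natl mulr2n lerD.
have cl b y : 0 < b -> `|Num.min 1 (u y / b)| <= 1.
  move=> b0; rewrite ger0_norm ?ge_min ?lexx//.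
  by rewrite le_min ler01 divr_ge0// ltW.
have ib b : 0 < b -> m.-integrable setT (EFin \o (fun y => Num.min 1 (u y / b) * (g y - c))).
  move=> b0; apply: (integrable_bounded m1 (B := 2 * B)) => [|y].
    exact: measurable_funM.
  by rewrite normrM (le_trans _ (gcB y))// ler_piMl// cl.
rewrite -RintegralB//; [|exact: ib|exact: ib].
apply: ler_norm_Rintegral => // [|y].
  by apply: measurable_funB; exact: measurable_funM.
rewrite -mulrBl normrM ler_pM//.
exact: clip_lipschitz.
Qed.

End clipped_integral.

Section feller_tempering.
Context (R : realType) d (E : polishType R d) (p : {mfun E >-> R}) (beta : R).
Hypotheses (p_continuous : continuous p) (p_gt0 : forall x, 0 < p x).
Variables (P : R.-pker E ~> E) (v : R) (v01 : 0 < v < 1).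

Lemma continuous_powR_density : continuous (fun x => p x `^ beta).
Proof.
move=> x; apply: (@continuous_comp _ _ _ p (fun t => t `^ beta)).
  exact: p_continuous.
apply/differentiable_continuous/derivable1_diffP.
by apply: derivable_powR; rewrite in_itv/= p_gt0.
Qed.

Lemma measurable_powR_density : measurable_fun setT (fun x => p x `^ beta).
Proof. exact: (measurableT_comp (measurable_powR beta) (measurable_funPT p)). Qed.

Lemma feller_Ptheta (theta : probability E R) :
  feller P -> feller (Ptheta p beta theta P v01).
Proof.
move=> fellerP f cf /bounded_funP[B B0 fB].
have mf := continuous_borel_measurable cf.
have [cPf bPf] : continuous (fun x => \int[P x]_y f y) /\
    bounded_fun (fun x => \int[P x]_y f y).
  by apply: fellerP => //; apply/bounded_funP; exists B.
have th1 : theta setT = 1%E by exact: probability_setT.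
split; last first.
  apply/bounded_funP; exists B => // x.
  by apply: ler_norm_Rintegral => //; exact: PthetaT.
have -> : (fun x => \int[Ptheta p beta theta P v01 x]_y f y) =
    (fun x => (1 - v) * \int[P x]_y f y +
      v * (f x + \int[theta]_y (acceptance p beta x y * (f y - f x)))).
  by apply/funext => x; exact: Rintegral_Ptheta mf fB.
move=> x; apply: cvgD; first by apply: cvgM; [exact: cvg_cst|exact: cPf].
apply: cvgM; first exact: cvg_cst.
apply: cvgD; first exact: cf.
pose I x := \int[theta]_y (acceptance p beta x y * (f y - f x)).
change (I z @[z --> x] --> I x).
pose u z := p z `^ beta.
have u0 z : 0 < u z by rewrite powR_gt0.
have Ilip z : `|I x - I z| <= `|u z - u x| / u x * (2 * B) + `|f x - f z|.
  (* pass from [x] to [z] in two moves: first in the centre, then in the acceptance *)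
  pose J := \int[theta]_y (acceptance p beta x y * (f y - f z)).
  rewrite -(subrKA J) (le_trans (ler_normD _ _))// addrC lerD//.
    rewrite distrC; apply: clipped_integral_lipschitz => //.
    - exact: measurable_powR_density.
    - by move=> y; exact: powR_ge0.
    - exact: u0.
    - exact: u0.
  have mfc c : measurable_fun setT (fun y => acceptance p beta x y * (f y - c)).
    by apply: measurable_funM; [exact: measurable_acceptancer|exact: measurable_funB].
  have ifc c : theta.-integrable setT (EFin \o (fun y => acceptance p beta x y * (f y - c))).
    apply: (integrable_bounded th1 (mfc c) (B := B + `|c|)) => y.
    rewrite normrM (le_trans (ler_piMl _ (norm_acceptance _ _ _ _)))//.
    by rewrite (le_trans (ler_normB _ _))// lerD2r.
  rewrite /I /J -RintegralB//.
  apply: ler_norm_Rintegral => [//||y].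
    exact: measurable_funB.
  rewrite -mulrBr opprB addrC subrKA normrM distrC.
  by rewrite ler_piMl// norm_acceptance.
have bound0 : `|u z - u x| / u x * (2 * B) + `|f x - f z| @[z --> x] --> 0.
  rewrite -[0]addr0 -[X in X + _](mul0r (2 * B)) -[X in X * _ + _](mul0r (u x)^-1).
  apply: cvgD.
    apply: cvgM; last exact: cvg_cst.
    apply: cvgM; last exact: cvg_cst.
    rewrite -(normr0 R) -(subrr (u x)); apply: cvg_norm; apply: cvgB; last exact: cvg_cst.
    exact: continuous_powR_density.
  rewrite -(normr0 R) -(subrr (f x)); apply: cvg_norm; apply: cvgB; first exact: cvg_cst.
  exact: cf.
apply/cvgrPdist_lt => e e0.
have /cvgrPdist_lt/(_ e e0) := bound0; apply: filterS => z.
rewrite sub0r normrN; apply: le_lt_trans; rewrite (le_trans (Ilip z))//.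
exact: ler_norm.
Qed.

End feller_tempering.

(** * Empirical measures and moments of the process *)

Section empirical_integral.
Context d (S : measurableType d) (R : realType) (u : nat -> S) (n : nat).

Lemma ge0_integral_empirical (h : S -> \bar R) :
  measurable_fun setT h -> (forall x, (0 <= h x)%E) ->
  (\int[empirical R u n]_x h x = (n.+1%:R^-1 : R)%:E * \sum_(k < n.+1) h (u k))%E.
Proof.
move=> mh h0; rewrite ge0_integral_mscale//=; congr (_ * _)%E.
rewrite ge0_integral_measure_sum//; apply: eq_bigr => k _.
by rewrite integral_dirac// diracT mul1e.
Qed.

Lemma Rintegral_empirical (h : S -> R) B :
  measurable_fun setT h -> (forall x, `|h x| <= B) ->
  \int[empirical R u n]_x h x = n.+1%:R^-1 * \sum_(k < n.+1) h (u k).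
Proof.
move=> mh hB; have e1 : empirical R u n setT = 1%E by exact: probability_setT.
apply: (@addIr _ B); rewrite -RintegralDcst//; last exact: integrable_bounded mh hB.
rewrite /Rintegral ge0_integral_empirical//; last 2 first.
- by apply/measurable_EFinP; exact: measurable_funD.
- by move=> x; rewrite lee_fin; have := hB x; rewrite ler_norml; lra.
rewrite sumEFin -EFinM /= big_split/= sumr_const card_ord -[B *+ _]mulr_natl mulrDr.
by rewrite mulKf// pnatr_eq0.
Qed.

End empirical_integral.

Section process.
Context (R : realType) d (E : polishType R d) (p : {mfun E >-> R}) (beta : R).
Variables (P : R.-pker E ~> E) (v : R) (v01 : 0 < v < 1).
Variable theta_star : probability E R.
Context d' (Omega : measurableType d') (Pr : probability Omega R).
Variables X Y : nat -> {mfun Omega >-> E}.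

Let theta n w : probability E R := empirical R (fun k => Y k w) n.
Let PrT : Pr setT = 1%E. Proof. exact: probability_setT. Qed.

Lemma measurable_empirical_integral n (h : E -> R) B :
  measurable_fun setT h -> (forall x, `|h x| <= B) ->
  measurable_fun setT (fun w => \int[theta n w]_x h x).
Proof.
move=> mh hB; under eq_fun do rewrite (Rintegral_empirical _ _ mh hB).
apply: measurable_funM => //; apply: measurable_sum => k.
exact: (measurableT_comp mh (measurable_funPT (Y k))).
Qed.

Lemma empirical_L1 (h : E -> R) B : measurable_fun setT h -> (forall x, `|h x| <= B) ->
  {ae Pr, forall w, (fun n => \int[theta n w]_x h x) @ \oo --> \int[theta_star]_x h x} ->
  (fun n => \int[Pr]_w `|\int[theta n w]_x h x - \int[theta_star]_x h x|) @ \oo --> (0 : R).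
Proof.
move=> mh hB aeh.
have mth n := measurable_empirical_integral n mh hB.
have mD n : measurable_fun setT
    (fun w => `|\int[theta n w]_x h x - \int[theta_star]_x h x|).
  by apply: measurableT_comp => //; exact: measurable_funB.
have DB n w : `|\int[theta n w]_x h x - \int[theta_star]_x h x| <= B + B.
  rewrite (le_trans (ler_normB _ _))// lerD// ler_norm_Rintegral//; exact: probability_setT.
have [] := @dominated_convergence _ _ _ Pr setT measurableT
  (fun n w => `|\int[theta n w]_x h x - \int[theta_star]_x h x|%:E) (cst 0%E) (cst (B + B)%:E).
- by move=> n; exact/measurable_EFinP.
- exact: measurable_cst.
- apply: filterS aeh => w cw _ /=; apply: cvg_EFin; first exact: nearW.
  rewrite -(normr0 R) -(subrr (\int[theta_star]_x h x)); apply: cvg_norm.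
  by apply: cvgB => //; exact: cvg_cst.
- exact: integrable_cst.
- by apply: aeW => w n _; rewrite /= lee_fin normr_id.
move=> _ _; rewrite integral0 => cv.
exact: (fine_cvg cv).
Qed.

Local Notation Pth n w := (Ptheta p beta (theta n w) P v01).

Hypothesis transition : forall n (f : E -> R), measurable_fun setT f -> bounded_fun f ->
  Pr.-integrable setT (EFin \o (fun w => \int[Pth n w (X n w)]_y f y)) /\
  (\int[Pr]_w (\int[Pth n w (X n w)]_y f y)%:E = \int[Pr]_w (f (X n.+1 w))%:E)%E.

Variable W : E -> R.
Hypotheses (mW : measurable_fun setT W) (W0 : forall x, 0 <= W x).

Section moments.
Variables (lambda b CY : R).
Hypotheses (lambda0 : 0 <= lambda) (lambda1 : lambda < 1) (b0 : 0 <= b).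
Hypothesis drift : forall x, (\int[P x]_y (W y)%:E <= (lambda * W x + b)%:E)%E.
Hypothesis WY : forall n, (\int[Pr]_w (W (Y n w))%:E <= CY%:E)%E.
Hypothesis WX0 : (\int[Pr]_w (W (X 0 w))%:E < +oo)%E.

Let mWc (Z : {mfun Omega >-> E}) : measurable_fun setT (fun w => (W (Z w))%:E).
Proof. by apply/measurable_EFinP; exact: (measurableT_comp mW (measurable_funPT Z)). Qed.

Let rho := (1 - v) * lambda + v.
Let mEW : measurable_fun setT (EFin \o W). Proof. exact/measurable_EFinP. Qed.

Let empirical_moment n : (\int[Pr]_w \int[theta n w]_x (W x)%:E <= CY%:E)%E.
Proof.
under eq_integral do rewrite ge0_integral_empirical//.
rewrite ge0_integralZl//; last 2 first.
- by apply: emeasurable_sum => k; exact: mWc.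
- by move=> w _; apply: sume_ge0 => k _; rewrite lee_fin.
rewrite ge0_integral_sum//; last first.
  by move=> k w _; rewrite lee_fin.
apply: (@le_trans _ _ ((n.+1%:R^-1)%:E * \sum_(k < n.+1) CY%:E)%E).
  by rewrite lee_wpmul2l// lee_sum.
rewrite sumEFin -EFinM lee_fin sumr_const card_ord -[CY *+ _]mulr_natl mulKf//.
Qed.

Let truncated_step n (N : nat) :
  (\int[Pr]_w (Num.min (W (X n.+1 w)) N%:R)%:E <=
   rho%:E * \int[Pr]_w (W (X n w))%:E + ((1 - v) * b + v * CY)%:E)%E.
Proof.
have /andP[v0 v1] := v01.
have v1' : 0 <= 1 - v by lra.
have rho0 : 0 <= rho by rewrite addr_ge0 ?mulr_ge0// ltW.
pose f x := Num.min (W x) N%:R.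
have mf : measurable_fun setT f by exact: measurable_minr.
have f0 x : 0 <= f x by rewrite le_min W0 ler0n.
have fN x : `|f x| <= N%:R by rewrite ger0_norm// ge_min lexx orbT.
have bf : bounded_fun f by apply/bounded_funP; exists N%:R.
have [iV VE] := transition n mf bf.
rewrite -[leLHS]/(\int[Pr]_w (f (X n.+1 w))%:E)%E -VE.
have mthW : measurable_fun setT (fun w => \int[theta n w]_x (W x)%:E)%E.
  under eq_fun do rewrite ge0_integral_empirical//.
  by apply: measurable_funeM; apply: emeasurable_sum => k; exact: mWc.
have thW0 w : (0 <= \int[theta n w]_x (W x)%:E)%E.
  by apply: integral_ge0 => x _; rewrite lee_fin.
apply: (@le_trans _ _ (\int[Pr]_w ((rho%:E * (W (X n w))%:E + ((1 - v) * b)%:E)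
    + v%:E * \int[theta n w]_x (W x)%:E))%E).
  apply: ge0_le_integral => //.
  - by move=> w _; rewrite lee_fin; apply: Rintegral_ge0.
  - exact: measurable_int iV.
  - apply: emeasurable_funD; last exact: measurable_funeM.
    by apply: emeasurable_funD => //; apply: measurable_funeM.
  - move=> w _; rewrite EFin_Rintegral; last exact: (integrable_bounded (PthetaT _ _ _ _ _ _) mf fN).
    rewrite -EFinM -EFinD.
    apply: le_trans (drift_Ptheta p beta v01 (theta n w) mW W0 (drift (X n w))).
    apply: ge0_le_integral => //.
    + by move=> x _; rewrite lee_fin.
    + exact/measurable_EFinP.
    + by move=> x _; rewrite lee_fin ge_min lexx.
rewrite ge0_integralD//; first last.
- exact: measurable_funeM.
- by move=> w _; apply: mule_ge0 => //; rewrite lee_fin ltW.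
- by apply: emeasurable_funD => //; apply: measurable_funeM.
- by move=> w _; rewrite -EFinM -EFinD lee_fin addr_ge0// mulr_ge0.
rewrite ge0_integralD//; first last.
- by move=> w _; rewrite lee_fin mulr_ge0.
- exact: measurable_funeM.
- by move=> w _; rewrite -EFinM lee_fin mulr_ge0.
rewrite integral_cst//= PrT mule1.
rewrite ge0_integralZl//; last by move=> w _; rewrite lee_fin.
have v0E : (0 <= v%:E)%E by rewrite lee_fin ltW.
rewrite ge0_integralZl; [|by []|exact: mthW|by move=> w _; exact: thW0|by []].
rewrite -addeA; apply: leeD; first exact: lexx.
rewrite EFinD; apply: leeD; first exact: lexx.
rewrite EFinM; apply: lee_wpmul2l => //.
exact: empirical_moment.
Qed.

(** The one-step drift of the process: [rho < 1] because the tempering move adds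
    at most [theta_n W] to [W], and the expectation of [theta_n W] is an average
    of the moments of [Y]. The conditional law of [X n.+1] is known on bounded
    functions only, so the drift is first obtained for the truncations of [W]. *)
Lemma moment_bound : exists2 C, 0 <= C & forall n, (\int[Pr]_w (W (X n w))%:E <= C%:E)%E.
Proof.
have /andP[v0 v1] := v01.
have lam := lambda1; have lam0 := lambda0.
have rho1 : 0 < 1 - rho by rewrite /rho; nra.
have rho0 : 0 <= rho by rewrite /rho; nra.
have K0 : 0 <= (1 - v) * b + v * CY.
  have CY0 : 0 <= CY.
    rewrite -lee_fin; apply: le_trans (WY 0); apply: integral_ge0 => w _.
    by rewrite lee_fin.
  by apply: addr_ge0; apply: mulr_ge0 => //; lra.
pose m0 := fine (\int[Pr]_w (W (X 0 w))%:E)%E.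
have m0E : (\int[Pr]_w (W (X 0 w))%:E = m0%:E)%E.
  rewrite fineK// ge0_fin_numE//; apply: integral_ge0 => w _; by rewrite lee_fin.
have m00 : 0 <= m0 by apply: fine_ge0; apply: integral_ge0 => w _; rewrite lee_fin.
move: K0; set K := _ + _ => K0.
exists (m0 + K / (1 - rho)); first by rewrite addr_ge0// divr_ge0// ltW.
elim=> [|n ih]; first by rewrite m0E lee_fin lerDl divr_ge0// ltW.
have stepN N : (\int[Pr]_w (Num.min (W (X n.+1 w)) N%:R)%:E <= (m0 + K / (1 - rho))%:E)%E.
  apply: le_trans (truncated_step n N) _.
  apply: (@le_trans _ _ (rho%:E * (m0 + K / (1 - rho))%:E + K%:E)%E).
    by rewrite leeD2r// lee_wpmul2l// lee_fin.
  rewrite -EFinM -EFinD lee_fin.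
  have KE : K = (1 - rho) * (K / (1 - rho)) by rewrite mulrC divfK// gt_eqF.
  have : 0 <= (1 - rho) * m0 by rewrite mulr_ge0// ltW.
  by move: KE; set t := K / (1 - rho); lra.
pose g (N : nat) w := (Num.min (W (X n.+1 w)) N%:R)%:E.
have gW w : g^~ w @ \oo --> (W (X n.+1 w))%:E.
  apply: cvg_near_cst; near=> N; rewrite /g; congr EFin; apply/min_idPl.
  by near: N; exact: nbhs_infty_ger.
have -> : (\int[Pr]_w (W (X n.+1 w))%:E = \int[Pr]_w limn (g^~ w))%E.
  by apply: eq_integral => w _; apply/esym/cvg_lim => //; exact: gW.
have mg N : measurable_fun setT (g N).
  by apply/measurable_EFinP; apply: measurable_minr => //; exact/measurable_EFinP/mWc.
have g0 N w : setT w -> (0 <= g N w)%E by rewrite lee_fin le_min W0 ler0n.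
have gnd w : setT w -> {homo g^~ w : i j / (i <= j)%N >-> (i <= j)%E}.
  move=> _ i j ij; rewrite lee_fin le_min ge_min lexx/=.
  by rewrite ge_min ler_nat ij orbT.
rewrite monotone_convergence//; apply: lime_le; last exact: nearW.
apply/cvg_ex; eexists.
exact: (cvg_monotone_convergence measurableT mg g0 gnd).
Unshelve. all: by end_near.
Qed.

End moments.
End process.

(** * Replacing the adapted kernel by its limit *)

Section L1_null.
Context d (O : measurableType d) (R : realType) (Pr : probability O R).
Implicit Types D : nat -> O -> R.

Definition L1_null D := [/\ forall n, measurable_fun setT (D n),
  exists K, forall n w, 0 <= D n w <= K &
  (fun n => \int[Pr]_w D n w) @ \oo --> (0 : R)].

Let PrT : Pr setT = 1%E. Proof. exact: probability_setT. Qed.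

Lemma L1_null_integrable D n : L1_null D -> Pr.-integrable setT (EFin \o D n).
Proof.
move=> [mD [K DK] _]; apply: (integrable_bounded PrT (mD n) (B := K)) => w.
by have /andP[? ?] := DK n w; rewrite ger0_norm.
Qed.

Lemma L1_null_add D1 D2 : L1_null D1 -> L1_null D2 -> L1_null (fun n w => D1 n w + D2 n w).
Proof.
move=> N1 N2; have [m1 [K1 D1K] c1] := N1; have [m2 [K2 D2K] c2] := N2; split.
- by move=> n; exact: measurable_funD.
- exists (K1 + K2) => n w; have /andP[? ?] := D1K n w; have /andP[? ?] := D2K n w.
  by rewrite addr_ge0//= lerD.
- under eq_fun => n do rewrite (RintegralD measurableT (L1_null_integrable n N1)
    (L1_null_integrable n N2)).
  by rewrite -[0]addr0; exact: cvgD.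
Qed.

Lemma L1_null_scale D c : 0 <= c -> L1_null D -> L1_null (fun n w => c * D n w).
Proof.
move=> c0 N; have [m [K DK] cD] := N; split.
- by move=> n; exact: measurable_funM.
- exists (c * K) => n w; have /andP[? ?] := DK n w.
  by rewrite mulr_ge0//= ler_wpM2l.
- under eq_fun => n do rewrite (RintegralZl _ measurableT (L1_null_integrable n N)).
  by rewrite -[0](mulr0 c); apply: cvgM => //; exact: cvg_cst.
Qed.

Lemma L1_null_sum (N : nat) (D : nat -> nat -> O -> R) : (forall j, L1_null (D j)) ->
  L1_null (fun n w => \sum_(j < N) D j n w).
Proof.
move=> ND; elim: N => [|N ih].
  under [X in L1_null X]eq_fun do under eq_fun do rewrite big_ord0.
  split=> //; first by exists 0 => n w; rewrite lexx.
  under eq_fun do rewrite Rintegral_cst_prob//.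
  exact: cvg_cst.
under [X in L1_null X]eq_fun do under eq_fun do rewrite big_ord_recr/=.
exact: L1_null_add.
Qed.

End L1_null.

Section one_step.
Context (R : realType) d (E : polishType R d) (p : {mfun E >-> R}) (beta : R).
Hypotheses (p_continuous : continuous p) (p_gt0 : forall x, 0 < p x).
Variables (P : R.-pker E ~> E) (v : R) (v01 : 0 < v < 1).
Variable theta_star : probability E R.
Context d' (Omega : measurableType d') (Pr : probability Omega R).
Variables X Y : nat -> {mfun Omega >-> E}.

Let theta n w : probability E R := empirical R (fun k => Y k w) n.
Let PrT : Pr setT = 1%E. Proof. exact: probability_setT. Qed.
Local Notation Pth n w := (Ptheta p beta (theta n w) P v01).
Local Notation Pstar := (Ptheta p beta theta_star P v01).
Local Notation u x := (p x `^ beta).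

Hypothesis lln : forall h : E -> R, continuous h -> bounded_fun h ->
  {ae Pr, forall w, (fun n => \int[theta n w]_x h x) @ \oo --> \int[theta_star]_x h x}.

Let dev (h : E -> R) n w : R := `|\int[theta n w]_x h x - \int[theta_star]_x h x|.

Let dev_L1_null h : continuous h -> bounded_fun h -> L1_null Pr (dev h).
Proof.
move=> ch bh; have [B B0 hB] := (bounded_funP h).1 bh.
have mh := continuous_borel_measurable ch; split.
- move=> n; apply: measurableT_comp => //; apply: measurable_funB => //.
  exact: measurable_empirical_integral mh hB.
- exists (B + B) => n w; rewrite normr_ge0/= (le_trans (ler_normB _ _))// lerD//;
  by apply: ler_norm_Rintegral => //; exact: probability_setT.
- exact: empirical_L1 mh hB (lln ch bh).
Qed.

Variables (Mu : R).
Hypothesis u_le : forall x, u x <= Mu.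

(** A finite grid for the value [u x] makes the law of large numbers uniform over
    the points where [u] is bounded away from zero. *)
Lemma uniform_lln (g : E -> R) B q eps : continuous g -> 0 <= B -> (forall x, `|g x| <= B) ->
  0 < q -> 0 < eps -> exists2 D, L1_null Pr D & forall n w x, q <= u x ->
  `|\int[theta n w]_y (acceptance p beta x y * (g y - g x)) -
    \int[theta_star]_y (acceptance p beta x y * (g y - g x))| <= D n w + eps.
Proof.
move=> cg B0 gB q0 eps0.
pose eta := eps * q / (4 * (B + 1)).
have B1 : 0 < 4 * (B + 1) by lra.
have eta0 : 0 < eta by rewrite divr_gt0// mulr_gt0.
have etaE : eta / q * (4 * B) <= eps.
  have -> : eta / q * (4 * B) = eps * (4 * B / (4 * (B + 1))).
    by rewrite /eta; field; rewrite gt_eqF//=; lra.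
  rewrite ler_piMr ?(ltW eps0)// ler_pdivrMr//; lra.
(* a grid of mesh [eta] on [q, Mu]; snapping [u x] to it costs [eps / 2] for
   each of the two measures *)
pose a j : R := q + j%:R * eta.
have aq j : q <= a j by rewrite lerDl mulr_ge0 ?(ltW eta0).
have a0 j : 0 < a j by exact: lt_le_trans (aq j).
pose h j y := Num.min 1 (u y / a j).
have ch j : continuous (h j).
  move=> x; apply: (@continuous_min _ _ (fun=> 1) (fun y => u y / a j)).
    exact: cvg_cst.
  by apply: cvgM; [exact: continuous_powR_density|exact: cvg_cst].
have h1 j y : `|h j y| <= 1.
  rewrite ger0_norm ?ge_min ?lexx//.
  by rewrite le_min ler01 divr_ge0 ?powR_ge0// ltW.
have chg j : continuous (fun y => h j y * g y).
  by move=> x; apply: cvgM; [exact: ch|exact: cg].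
have hgB j y : `|h j y * g y| <= B by rewrite normrM (le_trans _ (gB y))// ler_piMl.
have bh j : bounded_fun (h j) by apply/bounded_funP; exists 1.
have bhg j : bounded_fun (fun y => h j y * g y) by apply/bounded_funP; exists B.
pose Dj j n w := dev (fun y => h j y * g y) n w + B * dev (h j) n w.
have Dj0 j n w : 0 <= Dj j n w by rewrite addr_ge0 ?mulr_ge0// normr_ge0.
pose N := (Num.truncn (Mu / eta)).+1.
exists (fun n w => \sum_(j < N) Dj j n w).
  apply: L1_null_sum => j; apply: L1_null_add; first exact: dev_L1_null.
  by apply: L1_null_scale => //; exact: dev_L1_null.
move=> n w x qx.
have uxq0 : 0 <= (u x - q) / eta by rewrite divr_ge0 ?subr_ge0 ?(ltW eta0).
pose j0 := Num.truncn ((u x - q) / eta).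
have /andP[j1 j2] := truncn_itv uxq0.
have j0N : (j0 < N)%N.
  rewrite ltnS; apply: le_truncn; rewrite ler_pM2r ?invr_gt0//.
  by rewrite (le_trans _ (u_le x))// gerBl ltW.
have ajx : `|u x - a j0| <= eta.
  rewrite ler_pdivlMr// in j1; rewrite ltr_pdivrMr// -natr1 in j2.
  by rewrite ler_norml /a /j0; apply/andP; split; lra.
have mg := continuous_borel_measurable cg.
have mu := measurable_powR_density p beta.
have clip (m : probability E R) :
    `|\int[m]_y (acceptance p beta x y * (g y - g x)) -
      (\int[m]_y (h j0 y * g y) - g x * \int[m]_y h j0 y)| <= eps / 2.
  have m1 : m setT = 1%E by exact: probability_setT.
  have ih := integrable_bounded m1 (continuous_borel_measurable (ch j0)) (h1 j0).
  have ihg := integrable_bounded m1 (continuous_borel_measurable (chg j0)) (hgB j0).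
  have -> : \int[m]_y (h j0 y * g y) - g x * \int[m]_y h j0 y =
      \int[m]_y (h j0 y * (g y - g x)).
    rewrite -(RintegralZl _ measurableT ih) -(RintegralB measurableT ihg); last first.
      exact: (integrableZl measurableT (g x) ih).
    by apply: eq_Rintegral => y _; rewrite mulrBr [g x * _]mulrC.
  apply: le_trans (clipped_integral_lipschitz m1 mu (fun y => powR_ge0 _ _) mg gB (gB x) _ (a0 j0)) _.
    exact: lt_le_trans qx.
  have : `|u x - a j0| / a j0 * (2 * B) <= eta / q * (2 * B).
    apply: ler_wpM2r; first exact: mulr_ge0.
    have a0' : 0 <= (a j0)^-1 by rewrite invr_ge0 ltW.
    have aq' : (a j0)^-1 <= q^-1.
      by rewrite lef_pV2 ?aq// qualifE/= a0.
    exact: ler_pM.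
  lra.
have Dsum : Dj j0 n w <= \sum_(j < N) Dj j n w.
  rewrite (bigD1 (Ordinal j0N))//= lerDl; apply: sumr_ge0 => j _; exact: Dj0.
have gdev : `|g x * (\int[theta n w]_y h j0 y - \int[theta_star]_y h j0 y)| <=
    B * dev (h j0) n w by rewrite normrM ler_wpM2r.
have := clip (theta n w); have := clip theta_star; move: gdev Dsum.
rewrite /Dj /dev.
move: (\int[theta n w]_y (acceptance p beta x y * (g y - g x)))
  (\int[theta_star]_y (acceptance p beta x y * (g y - g x))).
move: (\int[theta n w]_y (h j0 y * g y)) (\int[theta_star]_y (h j0 y * g y)).
move: (\int[theta n w]_y h j0 y) (\int[theta_star]_y h j0 y).
move: (\sum_(j < N) _) => s b b' c c' e e'.
have := ler_norm (c - c'); have := ler_norm (c' - c); rewrite [`|c' - c|]distrC.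
rewrite !ler_norml mulrBr => *.
apply/andP; split; lra.
Qed.

Hypothesis transition : forall n (f : E -> R), measurable_fun setT f -> bounded_fun f ->
  Pr.-integrable setT (EFin \o (fun w => \int[Pth n w (X n w)]_y f y)) /\
  (\int[Pr]_w (\int[Pth n w (X n w)]_y f y)%:E = \int[Pr]_w (f (X n.+1 w))%:E)%E.

Variables (W : E -> R) (C : R).
Hypotheses (mW : measurable_fun setT W) (W0 : forall x, 0 <= W x) (C0 : 0 <= C).
Hypothesis WX : forall n, (\int[Pr]_w (W (X n w))%:E <= C%:E)%E.
Hypothesis level : forall L, exists2 q, 0 < q & forall x, W x <= L -> q <= u x.

Let integrableWX n : Pr.-integrable setT (EFin \o (fun w => W (X n w))).
Proof.
apply/integrableP; split.
  by apply/measurable_EFinP; exact: (measurableT_comp mW (measurable_funPT (X n))).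
under eq_integral do rewrite gee0_abs ?lee_fin//.
exact: le_lt_trans (WX n) (ltry _).
Qed.

(** Replacing the current adapted kernel by the limiting one costs nothing
    asymptotically: the points of high weight, where the law of large numbers is
    not uniform, are rare by Markov's inequality. *)
Lemma one_step_replacement (g : E -> R) : continuous g -> bounded_fun g ->
  (fun n => \int[Pr]_w g (X n.+1 w) - \int[Pr]_w kernel_op Pstar g (X n w)) @ \oo
    --> (0 : R).
Proof.
move=> cg bg; have [B B0 gB] := (bounded_funP g).1 bg.
have mg := continuous_borel_measurable cg.
have mPg := @kernel_op_measurable _ _ _ Pstar _ _ mg gB.
have PgB := @kernel_op_bounded _ _ _ Pstar _ _ mg gB.
have PgE x : kernel_op Pstar g x = (1 - v) * \int[P x]_y g y +
    v * (g x + \int[theta_star]_y (acceptance p beta x y * (g y - g x))).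
  exact: Rintegral_Ptheta mg gB.
move: (kernel_op Pstar g) mPg PgB PgE => Pg mPg PgB PgE.
have iPg n : Pr.-integrable setT (EFin \o (fun w => Pg (X n w))).
  apply: (integrable_bounded PrT _ (B := B)) => [|w]; last exact: PgB.
  exact: (measurableT_comp mPg (measurable_funPT (X n))).
apply/cvgrPdist_le => e e0.
pose L := 8 * (B + 1) * (C + 1) / e.
have C0' := C0.
have BC0 : 0 < 8 * (B + 1) * (C + 1) by apply: mulr_gt0 => //; lra.
have L0 : 0 < L by rewrite divr_gt0.
have [q q0 qu] := level L.
have e40 : 0 < e / 4 by rewrite divr_gt0.
have [D ND Dbound] := uniform_lln cg B0 gB q0 e40.
have [_ _ /cvgrPdist_le/(_ _ e40) Dsmall] := ND.
have [_ [K DK] _] := ND.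
apply: filterS Dsmall => n; rewrite !sub0r !normrN => Dn.
have [iV VE] := transition n mg bg.
pose V w := \int[Pth n w (X n w)]_y g y.
have VgE w : V w = (1 - v) * \int[P (X n w)]_y g y +
    v * (g (X n w) +
         \int[theta n w]_y (acceptance p beta (X n w) y * (g y - g (X n w)))).
  exact: Rintegral_Ptheta mg gB.
have VB w : `|V w| <= B.
  by apply: ler_norm_Rintegral => //; exact: PthetaT.
have -> : \int[Pr]_w g (X n.+1 w) = \int[Pr]_w V w by rewrite /Rintegral -VE.
have {}iV : Pr.-integrable setT (EFin \o V) by exact: iV.
clear VE; clearbody V.
rewrite -RintegralB//; apply: le_trans (le_normr_Rintegral _ _) _ => //.
  exact: (integrableB measurableT iV (iPg n)).
have iD := L1_null_integrable n ND.
have iDe : Pr.-integrable setT (EFin \o (fun w => D n w + e / 4)).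
  exact: (integrableD measurableT iD (integrable_cst _ PrT)).
have iWL : Pr.-integrable setT (EFin \o (fun w => 2 * B / L * W (X n w))).
  exact: (integrableZl measurableT (2 * B / L) (integrableWX n)).
apply: (@le_trans _ _ (\int[Pr]_w ((D n w + e / 4) + 2 * B / L * W (X n w)))).
  apply: le_Rintegral => //.
  - by apply: integrable_norm; exact: (integrableB measurableT iV (iPg n)).
  - exact: (integrableD measurableT iDe iWL).
  move=> w _ /=; have /andP[D0 _] := DK n w.
  set x := X n w.
  have BL0 : 0 <= 2 * B / L * W x by rewrite !mulr_ge0// invr_ge0 ltW.
  (* above level [L] the trivial bound [2 B] is at most [2 B W x / L] *)
  have [/qu qx|LW] := leP (W x) L.
    rewrite VgE PgE -/x.
    have := Dbound n w x qx; move: BL0.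
    set I := \int[theta n w]_y _; set I' := \int[theta_star]_y _ => BL0 II'.
    have -> : (1 - v) * \int[P x]_y g y + v * (g x + I) -
        ((1 - v) * \int[P x]_y g y + v * (g x + I')) = v * (I - I') by ring.
    have /andP[v0 v1] := v01.
    rewrite normrM gtr0_norm//; have := normr_ge0 (I - I'); nra.
  have -> : 2 * B / L * W x = 2 * B * (W x / L) by rewrite mulrAC mulrA.
  have WL : 1 <= W x / L by rewrite ler_pdivlMr// mul1r ltW.
  apply: (@le_trans _ _ (2 * B)).
    by rewrite mulr_natl mulr2n (le_trans (ler_normB _ _))// lerD.
  have : 2 * B <= 2 * B * (W x / L) by rewrite ler_peMr// mulr_ge0.
  lra.
rewrite (RintegralD measurableT iDe iWL) RintegralDcst// (RintegralZl _ measurableT (integrableWX n))//.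
have EW : \int[Pr]_w W (X n w) <= C by rewrite -lee_fin EFin_Rintegral.
have LE : 2 * B / L * C <= e / 4.
  have -> : 2 * B / L * C = e / 4 * (B * C / ((B + 1) * (C + 1))).
    rewrite /L; field; rewrite !gt_eqF//=; lra.
  rewrite ler_piMr ?(ltW e40)// ler_pdivrMr ?mulr_gt0//; nra.
have : 2 * B / L * \int[Pr]_w W (X n w) <= 2 * B / L * C.
  by rewrite ler_wpM2l// !mulr_ge0// invr_ge0 ltW.
have := ler_norm (\int[Pr]_w D n w); lra.
Qed.

End one_step.

(** * Ergodic limit of an asymptotically Markov process *)

Section asymptotically_markov.
Context (R : realType) d (E : polishType R d) (Q : R.-pker E ~> E).
Variable Pi : probability E R.
Hypotheses (Q_feller : feller Q) (Q_invariant : invariant_for Q Pi).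
Variables (W : E -> R) (rho B : R).
Hypotheses (mW : measurable_fun setT W) (W0 : forall x, 0 <= W x).
Hypotheses (rho0 : 0 <= rho) (rho1 : rho < 1) (B0 : 0 <= B).
Hypothesis drift : forall x, (\int[Q x]_y (W y)%:E <= (rho * W x + B)%:E)%E.
Hypothesis small : forall r, small1 Q [set x | W x <= r].
Hypothesis PiW : (\int[Pi]_x (W x)%:E < +oo)%E.
Context d' (Omega : measurableType d') (Pr : probability Omega R).
Variables (X : nat -> {mfun Omega >-> E}) (C : R).
Hypothesis WX : forall n, (\int[Pr]_w (W (X n w))%:E <= C%:E)%E.
Hypothesis step : forall g : E -> R, continuous g -> bounded_fun g ->
  (fun n => \int[Pr]_w g (X n.+1 w) - \int[Pr]_w kernel_op Q g (X n w)) @ \oo --> (0 : R).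

Let PiT : Pi setT = 1%E. Proof. exact: probability_setT. Qed.
Local Notation Qn m f := (iter m (kernel_op Q) f).

Let feller_iter m f : continuous f -> bounded_fun f ->
  continuous (Qn m f) /\ bounded_fun (Qn m f).
Proof. by move=> cf bf; elim: m => [//|m [cm bm]] /=; exact: Q_feller. Qed.

(** The one-step replacements telescope, since [Q] keeps test functions bounded
    and continuous. *)
Lemma lagged_replacement m f : continuous f -> bounded_fun f ->
  (fun n => \int[Pr]_w f (X (n + m)%N w) - \int[Pr]_w Qn m f (X n w)) @ \oo --> (0 : R).
Proof.
move=> cf bf; elim: m => [|m ih].
  by under eq_fun do rewrite addn0 subrr; exact: cvg_cst.
have [cm bm] := feller_iter m cf bf.
have -> : (fun n => \int[Pr]_w f (X (n + m.+1)%N w) - \int[Pr]_w Qn m.+1 f (X n w)) =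
  (fun n => (\int[Pr]_w f (X (n.+1 + m)%N w) - \int[Pr]_w Qn m f (X n.+1 w)) +
     (\int[Pr]_w Qn m f (X n.+1 w) - \int[Pr]_w kernel_op Q (Qn m f) (X n w))).
  by apply/funext => n; rewrite subrKA addnS addSn.
rewrite -[0]addr0; apply: cvgD; last exact: step.
by move: ih; rewrite -cvg_shiftS.
Qed.

Let invariant_iter m f : continuous f -> bounded_fun f ->
  \int[Pi]_x Qn m f x = \int[Pi]_x f x.
Proof.
move=> cf bf; elim: m => [//|m <-] /=.
have [cm /bounded_funP[M _ QM]] := feller_iter m cf bf.
apply/esym; apply: (Rintegral_mixture (nu := Pi) (q := Q)) QM => //.
- exact: measurable_kernel.
- by move=> A mA; rewrite Q_invariant.
- by move=> x; exact: prob_kernel.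
- exact: continuous_borel_measurable.
Qed.

Let center_bound d1 (S : measurableType d1) (m : probability S R) (Z : S -> E)
    (h : E -> R) (c K eta D : R) :
  measurable_fun setT Z -> (\int[m]_s (W (Z s))%:E <= D%:E)%E -> 0 <= K -> 0 <= eta ->
  measurable_fun setT h -> bounded_fun h ->
  (forall x, `|h x - c| <= K * (1 + eta * W x)) ->
  `|\int[m]_s h (Z s) - c| <= K * (1 + eta * D).
Proof.
move=> mZ WD K0 eta0 mh /bounded_funP[M _ hM] hc.
have m1 : m setT = 1%E by exact: probability_setT.
have mWZ := measurableT_comp mW mZ; have mhZ := measurableT_comp mh mZ.
have iW : m.-integrable setT (EFin \o (fun s => W (Z s))).
  apply/integrableP; split; first exact/measurable_EFinP.
  under eq_integral do rewrite gee0_abs ?lee_fin//.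
  exact: le_lt_trans WD (ltry _).
have ih := integrable_bounded m1 mhZ (fun s => hM (Z s)).
have ihc : m.-integrable setT (EFin \o (fun s => h (Z s) - c)).
  exact: (integrableB measurableT ih (integrable_cst c m1)).
rewrite -(RintegralDcst (- c) m1 ih).
apply: le_trans (le_normr_Rintegral measurableT ihc) _.
have iKW : m.-integrable setT (EFin \o (fun s => K * eta * W (Z s))).
  exact: (integrableZl measurableT (K * eta) iW).
have iB : m.-integrable setT (EFin \o (fun s => K * eta * W (Z s) + K)).
  exact: (integrableD measurableT iKW (integrable_cst K m1)).
apply: (@le_trans _ _ (\int[m]_s (K * eta * W (Z s) + K))).
  apply: le_Rintegral => //; first exact: integrable_norm.
  by move=> s _; apply: le_trans (hc (Z s)) _; lra.
rewrite RintegralDcst// (RintegralZl _ measurableT iW).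
have : \int[m]_s W (Z s) <= D by rewrite -lee_fin EFin_Rintegral.
by move=> /(ler_wpM2l (mulr_ge0 K0 eta0)); lra.
Qed.

(** The law of [X (n + m)] is close to that of [m] steps of [Q] from [X n], and
    these forget [X n] at a rate that does not depend on [n]. *)
Lemma asymptotically_markov_cvg f : continuous f -> bounded_fun f ->
  (fun n => \int[Pr]_w f (X n w)) @ \oo --> \int[Pi]_x f x.
Proof.
move=> cf bf; have [M M0 fM] := (bounded_funP f).1 bf.
have mf := continuous_borel_measurable cf.
have [kappa [eta [/andP[k0 k1] eta0 erg]]] := harris_ergodic mW W0 rho0 rho1 B0 drift small.
pose D := fine (\int[Pi]_x (W x)%:E)%E.
have DE : (\int[Pi]_x (W x)%:E = D%:E)%E.
  by rewrite fineK// ge0_fin_numE//; apply: integral_ge0 => x _; rewrite lee_fin.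
apply/cvgrPdist_le => e e0.
pose G := M * (1 + eta * C) + M * (1 + eta * D).
have : kappa ^+ m * G @[m --> \oo] --> (0 : R).
  rewrite -(mul0r G); apply: cvgM; last exact: cvg_cst.
  by apply: cvg_expr; rewrite ger0_norm.
have e20 : 0 < e / 2 by rewrite divr_gt0.
move=> /cvgrPdist_le/(_ _ e20)[m _ /(_ m (leqnn m))]; rewrite sub0r normrN => Gm.
have [c erg_m] := erg f M m mf fM M0.
have [cm bm] := feller_iter m cf bf.
have mm := continuous_borel_measurable cm.
have K0 : 0 <= kappa ^+ m * M by rewrite mulr_ge0// exprn_ge0.
have Pic : `|\int[Pi]_x f x - c| <= kappa ^+ m * M * (1 + eta * D).
  rewrite -(invariant_iter m cf bf).
  apply: (center_bound (Z := id)) => //.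
  by rewrite DE.
have Xc n : `|\int[Pr]_w Qn m f (X n w) - c| <= kappa ^+ m * M * (1 + eta * C).
  exact: (center_bound (measurable_funPT (X n)) (WX n)).
have := lagged_replacement m cf bf.
move=> /cvgrPdist_le/(_ _ e20)[N _ lag].
exists (N + m)%N => // n /= Nmn.
have mn : (m <= n)%N by exact: leq_trans (leq_addl _ _) Nmn.
have := lag (n - m)%N; rewrite /= leq_subRL// addnC => /(_ Nmn).
rewrite sub0r normrN subnK//.
have := Xc (n - m)%N; move: Pic Gm; rewrite /G.
move: (kappa ^+ m) => k.
move: (\int[Pr]_w f (X n w)) (\int[Pi]_x f x) (\int[Pr]_w Qn m f (X (n - m)%N w)) => a p q.
have := ler_norm (k * (M * (1 + eta * C) + M * (1 + eta * D))).
rewrite !ler_norml => ? ? /andP[? ?] /andP[? ?] /andP[? ?].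
by apply/andP; split; lra.
Qed.

End asymptotically_markov.

(** * Lyapunov weight and tempered density *)

Section lyapunov_weight.
Context d (S : measurableType d) (R : realType) (p : {mfun S >-> R}).
Hypotheses (p_gt0 : forall x, 0 < p x) (p_bounded : bounded_fun p).

Lemma le_supnorm x : p x <= supnorm p.
Proof.
have /bounded_funP[B _ pB] := p_bounded.
rewrite -[p x]gtr0_norm//; apply: ub_le_sup; last by exists x.
by exists B => _ [y _ <-].
Qed.

Variable tau : R.
Local Notation W := (lyapunov p tau).

Lemma measurable_lyapunov : measurable_fun setT W.
Proof.
apply: (measurableT_comp (measurable_powR (- tau))).
by apply: measurable_funM => //; exact: measurable_funPT.
Qed.

Lemma lyapunov_ge0 x : 0 <= W x. Proof. exact: powR_ge0. Qed.

Hypothesis tau_gt0 : 0 < tau.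

Lemma lyapunov_ge1 x : 1 <= W x.
Proof.
have s0 : 0 < supnorm p by exact: lt_le_trans (le_supnorm x).
have r0 : 0 < p x / supnorm p by rewrite divr_gt0.
have r1 : p x / supnorm p <= 1 by rewrite ler_pdivrMr// mul1r le_supnorm.
rewrite /lyapunov powRN invf_ge1 ?powR_gt0//.
have := ge0_ler_powR (ltW tau_gt0) (ltW r0) (ler01 : 1 \in Num.nneg) r1.
by rewrite powR1.
Qed.

Lemma lyapunov_level (x0 : S) L :
  exists2 q, 0 < q < supnorm p & forall x, W x <= L -> q <= p x.
Proof.
have s0 : 0 < supnorm p by exact: lt_le_trans (le_supnorm x0).
(* [q] is the density at which [W] takes the value [l]; [1 < l] keeps [q] below
   the supremum of [p] *)
pose l := Num.max L 1 + 1.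
have mL : L <= Num.max L 1 by rewrite le_max lexx.
have m1 : 1 <= Num.max L 1 by rewrite le_max lexx orbT.
have l1 : 1 < l by rewrite ltr_pwDr.
have lL : L < l by rewrite ltr_pwDr.
have l0 : 0 < l by exact: lt_trans l1.
have ti0 : 0 < tau^-1 by rewrite invr_gt0.
pose t := l `^ (- tau^-1).
have t0 : 0 < t by rewrite powR_gt0.
have t1 : t < 1.
  rewrite /t powRN invf_lt1 ?powR_gt0//.
  have := gt0_ltr_powR ti0 (ler01 : 1 \in Num.nneg) (ltW l0) l1.
  by rewrite powR1.
have tt : t `^ tau = l^-1.
  by rewrite /t -powRrM mulNr mulVf ?gt_eqF// powRN powRr1// ltW.
exists (supnorm p * t); first by rewrite mulr_gt0//= gtr_pMr.
move=> x WL; rewrite leNgt; apply/negP => pt.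
suff : l < W x by move=> /(lt_trans lL); rewrite ltNge WL.
have r0 : 0 < p x / supnorm p by rewrite divr_gt0.
rewrite /lyapunov powRN -[l]invrK -tt ltf_pV2 ?qualifE/= ?powR_gt0//.
by rewrite gt0_ltr_powR ?nnegrE ?(ltW r0) ?(ltW t0)// ltr_pdivrMr// mulrC.
Qed.

End lyapunov_weight.

Section tempered_density.
Context d (S : measurableType d) (R : realType) (p : {mfun S >-> R}).
Hypothesis p_gt0 : forall x, 0 < p x.
Variables (mu : {measure set S -> \bar R}) (Pi theta : probability S R) (T c : R).
Hypothesis PiE : has_density mu Pi p.
Hypothesis thetaE : has_density mu theta (fun x => c * p x `^ T^-1).

Lemma tempering_constant_gt0 : 0 < c.
Proof.
rewrite ltNge; apply/negP => c0.
have : (theta setT <= 0)%E.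
  have g0 x : (0 <= (- c * p x `^ T^-1)%:E)%E.
    by rewrite lee_fin mulr_ge0 ?oppr_ge0// powR_ge0.
  rewrite thetaE//.
  have -> : (\int[mu]_x (c * p x `^ T^-1)%:E = - \int[mu]_x (- c * p x `^ T^-1)%:E)%E.
    by rewrite -integral_ge0N//; apply: eq_integral => x _; rewrite -EFinN mulNr opprK.
  by rewrite oppe_le0; exact: integral_ge0.
by rewrite (probability_setT theta) lee_fin ler10.
Qed.

Let measurable_powR_p r : measurable_fun setT (fun x => p x `^ r).
Proof. exact: (measurableT_comp (measurable_powR r) (measurable_funPT p)). Qed.

(** Detailed balance is an exchange of integrals; with this density it takes place
    over the probability [Pi]. *)
Lemma tempered_has_density : has_density Pi theta (fun x => c * p x `^ (- (1 - T^-1))).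
Proof.
move=> A mA; have c0 := ltW tempering_constant_gt0.
pose h x := (c * p x `^ (- (1 - T^-1)))%:E.
have h0 x : (0 <= h x)%E by rewrite lee_fin mulr_ge0// powR_ge0.
have mh : measurable_fun setT h.
  by apply/measurable_EFinP; exact: measurable_funM.
rewrite thetaE// [RHS]integral_mkcond.
rewrite (integral_has_density (measurable_funPT p) (fun x => ltW (p_gt0 x)) PiE).
- rewrite integral_mkcond; apply: eq_integral => x _.
  rewrite !patchE; case: ifPn => _; last by rewrite mule0.
  rewrite -EFinM; congr EFin; rewrite mulrCA; congr (_ * _).
  rewrite -{2}(powRr1 (ltW (p_gt0 x))) -powRD; last first.
    by rewrite (gt_eqF (p_gt0 x)) implybT.
  by congr (_ `^ _); ring.
- by apply/(measurable_restrictT _ _).1 => //; exact: measurable_funTS.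
- by move=> x; rewrite patchE; case: ifP => // _; exact: h0.
Qed.

(** The density of [theta] with respect to [Pi] is bounded below, as [p] is
    bounded above. *)
Lemma tempered_moment (W : S -> R) M : 1 <= T -> (forall x, p x <= M) ->
  measurable_fun setT W -> (forall x, 0 <= W x) ->
  (\int[theta]_x (W x)%:E < +oo)%E -> (\int[Pi]_x (W x)%:E < +oo)%E.
Proof.
move=> T1 pM mW W0 thW; have c0 := tempering_constant_gt0.
have T0 : 0 < T by exact: lt_le_trans T1.
have beta0 : 0 <= 1 - T^-1 by rewrite subr_ge0 invf_le1.
have dens0 x : 0 <= c * p x `^ (- (1 - T^-1)) by rewrite mulr_ge0 ?powR_ge0// ltW.
have mdens : measurable_fun setT (fun x => c * p x `^ (- (1 - T^-1))).
  exact: measurable_funM.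
have mEW : measurable_fun setT (EFin \o W) by exact/measurable_EFinP.
have EW0 x : (0 <= (W x)%:E)%E by rewrite lee_fin.
rewrite (integral_has_density mdens dens0 tempered_has_density)// in thW.
pose k := c / (M `^ (1 - T^-1)).
have [[x0 _]|noS] := pselect (exists x : S, True); last first.
  by rewrite integral0_eq ?ltry// => x _; exfalso; apply: noS; exists x.
have M0 : 0 < M by exact: lt_le_trans (pM x0).
have k0 : 0 < k by rewrite divr_gt0// powR_gt0.
have : (k%:E * \int[Pi]_x (W x)%:E < +oo)%E.
  apply: le_lt_trans thW; rewrite -ge0_integralZl//; last by rewrite lee_fin ltW.
  apply: ge0_le_integral => //.
  - by move=> x _; rewrite mule_ge0// lee_fin ltW.
  - exact: measurable_funeM.
  - by apply: emeasurable_funM => //; exact/measurable_EFinP.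
  - move=> x _; rewrite lee_wpmul2r// lee_fin /k ler_wpM2l ?(ltW c0)//.
    rewrite powRN lef_pV2 ?qualifE/= ?powR_gt0//.
    by rewrite ge0_ler_powR ?nnegrE ?(ltW M0) ?(ltW (p_gt0 x)).
have : (0 <= \int[Pi]_x (W x)%:E)%E by exact: integral_ge0.
case: (\int[Pi]_x (W x)%:E)%E => [r||]//; first by move=> _ _; exact: ltry.
by rewrite gt0_muley ?lte_fin.
Qed.

End tempered_density.

(** * Convergence of the interacting tempering process *)

Unset Implicit Arguments.
Set Strict Implicit.
Set Printing Implicit Defensive.

Theorem theorem3p4 (R : realType)
  (d : measure_display) (E : polishType R d) (mu : {measure set E -> \bar R})
  (dens : {mfun E >-> R}) (dens_ge0 : forall x, 0 <= dens x)
  (Pi : probability E R) (PiE : has_density mu Pi dens)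
  (T : R) (T_gt1 : 1 < T) (v : R) (v01 : 0 < v < 1)
  (P : R.-pker E ~> E)
  (theta_star : probability E R)
  (theta_starE : exists c : R,
     has_density mu theta_star (fun x => c * dens x `^ T^-1))
  (d' : measure_display) (Omega : measurableType d') (Pr : probability Omega R)
  (X Y : nat -> {mfun Omega >-> E})
  (theta := fun (n : nat) (w : Omega) =>
     empirical R (fun k => Y k w) n : pprobability E R)
  (Y_lln : forall f : E -> R, continuous f -> bounded_fun f ->
     {ae Pr, forall w,
       (fun n : nat => n%:R^-1 * \sum_(1 <= k < n.+1) f (Y k w)) @ \oo
         --> \int[theta_star]_x f x})
  (F : nat -> set (set Omega)) (F_filtration : filtration F)
  (X_adapted : forall n, measurable_for (F n) (X n))
  (theta_adapted : forall n, measurable_for (F n) (theta n))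
  (X_transition : forall (n : nat) (f : E -> R),
     measurable_fun [set: E] f -> bounded_fun f ->
     is_condexp Pr (F n) (fun w => f (X n.+1 w))
       (fun w => \int[Ptheta dens (1 - T^-1) (theta n w) P v01 (X n w)]_y f y))
  (dens_continuous : continuous dens) (dens_gt0 : forall x, 0 < dens x)
  (dens_bounded : bounded_fun dens)
  (P_irreducible : phi_irreducible Pi P) (P_aperiodic : aperiodic Pi P)
  (P_feller : feller P) (P_invariant : invariant_for P Pi)
  (tau : R) (tau_lt : 0 < tau < T^-1) (lambda : R) (lambda01 : 0 < lambda < 1)
  (b : R) (W := lyapunov dens tau)
  (P_drift : forall x,
     (\int[P x]_y (W y)%:E <= (lambda * W x + b)%:E)%E)
  (P_small : forall q : R, 0 < q < supnorm dens ->
     small1 P [set x | q <= dens x])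
  (theta_star_W : (\int[theta_star]_x (W x)%:E < +oo)%E)
  (theta_lln : forall f : E -> R, continuous f ->
     has_ubound (range (fun x => `|f x| / W x)) ->
     {ae Pr, forall w,
       (fun n : nat => \int[theta n w]_x f x) @ \oo
         --> \int[theta_star]_x f x})
  (Y_moment :
     (ereal_sup (range (fun n : nat => 'E_Pr[fun w => W (Y n w)])) < +oo)%E)
  (X0_moment : ('E_Pr[fun w => W (X 0%N w)] < +oo)%E) :
  forall f : E -> R, continuous f -> bounded_fun f ->
    'E_Pr[fun w => f (X n w)]%E @[n --> \oo] --> (\int[Pi]_x (f x)%:E)%E.
Proof.
move=> f cf bf.
pose beta := 1 - T^-1.
have T0 : 0 < T by exact: lt_trans T_gt1.
have beta_ge0 : 0 <= beta by rewrite subr_ge0 invf_le1// ltW.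
have /andP[tau0 tau1] := tau_lt; have /andP[lam0 lam1] := lambda01.
have /andP[v0 v1] := v01.
have PrT : Pr setT = 1%E by exact: probability_setT.
have [x0 _] : exists x : E, True.
  apply: contrapT => noE; have : Pi setT = 1%E by exact: probability_setT.
  rewrite (_ : setT = set0) ?measure0; last first.
    by apply/seteqP; split=> // x _; apply: noE; exists x.
  by move=> /esym/eqP; rewrite onee_eq0.
have mW := measurable_lyapunov dens tau : measurable_fun setT W.
have W0 := lyapunov_ge0 dens tau : forall x, 0 <= W x.
have W1 : forall x, 1 <= W x by exact: lyapunov_ge1.
have p_le := le_supnorm dens_gt0 dens_bounded.
have [c thE] := theta_starE.
have c0 := tempering_constant_gt0 thE.
have PiW : (\int[Pi]_x (W x)%:E < +oo)%E.
  exact: (tempered_moment dens_gt0 PiE thE (ltW T_gt1) p_le).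
have lln (h : E -> R) : continuous h -> bounded_fun h -> {ae Pr, forall w,
    (fun n => \int[empirical R (fun k => Y k w) n]_x h x) @ \oo --> \int[theta_star]_x h x}.
  move=> ch /bounded_funP[B B0 hB]; apply: theta_lln => //.
  exists B => _ [x _ <-]; rewrite ler_pdivrMr; last exact: lt_le_trans (W1 x).
  by rewrite (le_trans (hB x))// ler_peMr.
have transition n (g : E -> R) : measurable_fun setT g -> bounded_fun g ->
   Pr.-integrable setT (EFin \o (fun w => \int[Ptheta dens beta
     (empirical R (fun k => Y k w) n) P v01 (X n w)]_y g y)) /\
   (\int[Pr]_w (\int[Ptheta dens beta (empirical R (fun k => Y k w) n) P v01 (X n w)]_y g y)%:E
    = \int[Pr]_w (g (X n.+1 w))%:E)%E.
  move=> mg bg; have [_ iV VE] := X_transition n g mg bg; split; first exact: iV.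
  apply: VE; have [sF _ _] := F_filtration; have [F0 FC _] := sF n.
  by rewrite -(setD0 setT); exact: FC.
(* the drift constant [b] may be negative *)
have b0 : 0 <= `|b| by [].
have driftP x : (\int[P x]_y (W y)%:E <= (lambda * W x + `|b|)%:E)%E.
  by apply: le_trans (P_drift x) _; rewrite lee_fin lerD2l ler_norm.
have EY_ge0 n : (0 <= 'E_Pr[fun w => W (Y n w)])%E by exact: expectation_ge0.
pose CY := fine (ereal_sup (range (fun n => 'E_Pr[fun w => W (Y n w)])))%E.
have WY n : (\int[Pr]_w (W (Y n w))%:E <= CY%:E)%E.
  rewrite fineK.
    by apply: ereal_sup_ubound; exists n => //; rewrite unlock.
  rewrite ge0_fin_numE// (le_trans (EY_ge0 0%N))//.
  by apply: ereal_sup_ubound; exists 0%N.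
have WX0 : (\int[Pr]_w (W (X 0 w))%:E < +oo)%E by move: X0_moment; rewrite unlock.
have [C C0 WX] := moment_bound transition mW W0 (ltW lam0) lam1 b0 driftP WY WX0.
have level L : exists2 q, 0 < q & forall x, W x <= L -> q <= dens x `^ beta.
  have [q /andP[q0 _] Wq] := lyapunov_level dens_gt0 dens_bounded tau0 x0 L.
  exists (q `^ beta); first exact: powR_gt0.
  by move=> x /Wq qx; apply: ge0_ler_powR => //; rewrite nnegrE ?ltW.
have u_le x : dens x `^ beta <= supnorm dens `^ beta.
  by apply: ge0_ler_powR => //; rewrite nnegrE ltW// (lt_le_trans (dens_gt0 x0)).
have step := one_step_replacement dens_continuous dens_gt0 lln u_le transition mW W0 C0 WX level.
have th_fin : (\int[theta_star]_x (W x)%:E)%E \is a fin_num.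
  by rewrite ge0_fin_numE//; apply: integral_ge0 => x _; rewrite lee_fin.
pose rho := (1 - v) * lambda + v.
pose B := (1 - v) * `|b| + v * fine (\int[theta_star]_x (W x)%:E)%E.
have driftQ x : (\int[Ptheta dens beta theta_star P v01 x]_y (W y)%:E <=
    (rho * W x + B)%:E)%E.
  apply: le_trans (drift_Ptheta dens beta v01 theta_star mW W0 (driftP x)) _.
  by rewrite -(fineK th_fin) -EFinM -EFinD /B addrA.
have smallQ r : small1 (Ptheta dens beta theta_star P v01) [set x | W x <= r].
  apply: small_Ptheta; have [q q0 Wq] := lyapunov_level dens_gt0 dens_bounded tau0 x0 r.
  have [delta delta0 [nu minor]] := P_small q q0.
  by exists delta => //; exists nu => x A /Wq qx; exact: minor.
have rho0 : 0 <= rho by rewrite /rho; nra.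
have rho1 : rho < 1 by rewrite /rho; nra.
have B0 : 0 <= B.
  have th0 : 0 <= fine (\int[theta_star]_x (W x)%:E)%E.
    by apply: fine_ge0; apply: integral_ge0 => x _; rewrite lee_fin.
  by apply: addr_ge0; apply: mulr_ge0 => //; lra.
have Q_feller : feller (Ptheta dens beta theta_star P v01) by exact: feller_Ptheta.
have Q_invariant : invariant_for (Ptheta dens beta theta_star P v01) Pi.
  exact: (invariant_Ptheta v01 dens_gt0 (ltW c0) (tempered_has_density dens_gt0 PiE thE)).
have := asymptotically_markov_cvg Q_feller Q_invariant
  mW W0 rho0 rho1 B0 driftQ smallQ PiW WX step cf bf.
have [M M0 fM] := (bounded_funP f).1 bf.
have mf := continuous_borel_measurable cf.
have PiT : Pi setT = 1%E by exact: probability_setT.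
rewrite -(EFin_Rintegral (integrable_bounded PiT mf fM)) => cvX.
have -> : (fun n => 'E_Pr[fun w => f (X n w)])%E = (fun n => (\int[Pr]_w f (X n w))%:E).
  apply/funext => n; rewrite unlock EFin_Rintegral//.
  apply: (integrable_bounded PrT _ (B := M)) => //.
  exact: (measurableT_comp mf (measurable_funPT (X n))).
by apply: cvg_EFin; first exact: nearW.
Qed.
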